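(* Let $p$ be a prime, let $K$ be a finite extension of $\mathbf{Q}_p$ with ring of integers $\mathcal{O}_K$, and let $E/\mathcal{O}_K$ be a Weierstrass curve with additive reduction. Then the group $E_0(K)$ is a finitely generated $\mathbf{Z}_p$-module. Furthermore, the $\mathbf{Z}_p$-module topology and the standard topology on $E_0(K)$ coincide.
   Context: A Weierstrass curve over $\mathcal{O}_K$ is a projective curve $E\subset\mathbf{P}^2_{\mathcal{O}_K}$ defined by an equation $Y^2 + a_1XY + a_3Y = X^3+ a_2X^2 + a_4X + a_6$ with $a_i\in\mathcal{O}_K$, whose generic fiber is an elliptic curve with origin $(0:1:0)$. It has additive reduction if its special fiber over the residue field $k$ is cuspidal (singular with exactly one tangent direction at the singular point). $E_0(K)\subset E(K)$ is the subgroup of points whose reduction is a non-singular point of the special fiber. The standard topology on $E_0(K)$ is the one induced from $\mathbf{P}^2(K)$, which has the quotient topology from $K^3\setminus\{0\}$, with $K$ carrying the $p$-adic topology. The $\mathbf{Z}_p$-module structure on $E_0(K)$ is one extending its $\mathbf{Z}$-module structure. For a finitely generated $\mathbf{Z}_p$-module $G$, the $\mathbf{Z}_p$-module topology is the group topology in which $\{p^iG : i\in\mathbf{Z}_{\ge 0}\}$ is a fundamental system of neighborhoods of $0$. *)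

(* Defs.v *)
From HB Require Import structures.
From mathcomp Require Import all_boot all_order all_algebra all_field.
From mathcomp Require Import generic_quotient.
From mathcomp Require Import all_classical.
From mathcomp Require Import topology.

Set Implicit Arguments.
Unset Strict Implicit.
Unset Printing Implicit Defensive.
Import GRing.Theory.
Local Open Scope ring_scope.

(** [Z_p], the inverse limit of the rings [Z/p^n]; the index is shifted because
    ['Z_m] is only the ring of integers modulo [m] when [1 < m]. *)
Record padic_int (p : nat) (p_pr : prime p) := PadicInt {
  padic_mod :> forall n, 'Z_(p ^ n.+1);
  padic_compat : forall n, (padic_mod n.+1 : nat)%:R = padic_mod n
}.

Section PadicInt.
Variables (p : nat) (p_pr : prime p).
Local Notation Zp := (padic_int p_pr).
Implicit Types x y z : Zp.

Lemma padic_intP x y : (forall n, x n = y n) -> x = y.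
Proof.
case: x y => [x xP] [y yP] /= exy.
have e : x = y by apply: functional_extensionality_dep.
by subst y; congr PadicInt; apply: Prop_irrelevance.
Qed.

HB.instance Definition _ := gen_eqMixin Zp.
HB.instance Definition _ := gen_choiceMixin Zp.

Lemma ppow_gt1 n : (1 < p ^ n.+1)%N.
Proof. by rewrite -(exp1n n.+1) ltn_exp2r // prime_gt1. Qed.

Lemma Zpow_eq n (a b : nat) :
  (a%:R == b%:R :> 'Z_(p ^ n.+1)) = (a == b %[mod p ^ n.+1]).
Proof.
by rewrite -val_eqE /= !val_Zp_nat ?ppow_gt1.
Qed.

Lemma Zpow_eqP n (a b : nat) : a = b %[mod p ^ n.+1] ->
  a%:R = b%:R :> 'Z_(p ^ n.+1).
Proof. by move=> e; apply/eqP; rewrite Zpow_eq; apply/eqP. Qed.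

Definition Zpow_red n (a : 'Z_(p ^ n.+2)) : 'Z_(p ^ n.+1) := (a : nat)%:R.

Lemma Zpow_red_nat n (a : nat) : Zpow_red (a%:R : 'Z_(p ^ n.+2)) = a%:R.
Proof.
apply: Zpow_eqP; rewrite val_Zp_nat ?ppow_gt1 //.
by rewrite modn_dvdm // [(p ^ n.+2)%N]expnS dvdn_mull.
Qed.

Lemma Zpow_redD n : {morph @Zpow_red n : a b / a + b}.
Proof.
by move=> a b; rewrite -[a]natr_Zp -[b]natr_Zp -natrD !Zpow_red_nat natrD.
Qed.

Lemma Zpow_redM n : {morph @Zpow_red n : a b / a * b}.
Proof.
by move=> a b; rewrite -[a]natr_Zp -[b]natr_Zp -natrM !Zpow_red_nat natrM.
Qed.

Lemma Zpow_red0 n : @Zpow_red n 0 = 0. Proof. exact: (Zpow_red_nat n 0). Qed.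
Lemma Zpow_red1 n : @Zpow_red n 1 = 1. Proof. exact: (Zpow_red_nat n 1). Qed.

Lemma Zpow_redN n : {morph @Zpow_red n : a / - a}.
Proof.
by move=> a; apply/eqP; rewrite -subr_eq0 opprK -Zpow_redD addNr Zpow_red0.
Qed.

Definition padic0 : Zp := @PadicInt p p_pr (fun=> 0) Zpow_red0.
Definition padic1 : Zp := @PadicInt p p_pr (fun=> 1) Zpow_red1.

Program Definition padic_add x y : Zp := @PadicInt p p_pr (fun n => x n + y n) _.
Next Obligation.
by move=> x y n; rewrite -[LHS]/(Zpow_red _) Zpow_redD; congr (_ + _);
  apply: padic_compat.
Qed.

Program Definition padic_mul x y : Zp := @PadicInt p p_pr (fun n => x n * y n) _.
Next Obligation.
by move=> x y n; rewrite -[LHS]/(Zpow_red _) Zpow_redM; congr (_ * _);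
  apply: padic_compat.
Qed.

Program Definition padic_opp x : Zp := @PadicInt p p_pr (fun n => - x n) _.
Next Obligation.
by move=> x n; rewrite -[LHS]/(Zpow_red _) Zpow_redN; congr (- _);
  apply: padic_compat.
Qed.

Fact padic_addA : associative padic_add.
Proof. by move=> x y z; apply: padic_intP => n; apply: addrA. Qed.
Fact padic_addC : commutative padic_add.
Proof. by move=> x y; apply: padic_intP => n; apply: addrC. Qed.
Fact padic_add0 : left_id padic0 padic_add.
Proof. by move=> x; apply: padic_intP => n; apply: add0r. Qed.
Fact padic_addN : left_inverse padic0 padic_opp padic_add.
Proof. by move=> x; apply: padic_intP => n; apply: addNr. Qed.
Fact padic_mulA : associative padic_mul.
Proof. by move=> x y z; apply: padic_intP => n; apply: mulrA. Qed.
Fact padic_mulC : commutative padic_mul.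
Proof. by move=> x y; apply: padic_intP => n; apply: mulrC. Qed.
Fact padic_mul1 : left_id padic1 padic_mul.
Proof. by move=> x; apply: padic_intP => n; apply: mul1r. Qed.
Fact padic_mulDl : left_distributive padic_mul padic_add.
Proof. by move=> x y z; apply: padic_intP => n; apply: mulrDl. Qed.
Fact padic_1neq0 : padic1 != padic0.
Proof.
apply/eqP => /(congr1 (fun x : Zp => x 0%N)) /= /eqP.
rewrite -[_ == _]/(1%:R == 0%:R :> 'Z_(p ^ 1)) Zpow_eq mod0n expn1.
by rewrite modn_small ?prime_gt1.
Qed.

HB.instance Definition _ :=
  GRing.isZmodule.Build Zp padic_addA padic_addC padic_add0 padic_addN.
HB.instance Definition _ := GRing.Zmodule_isComNzRing.Build Zp
  padic_mulA padic_mulC padic_mul1 padic_mulDl padic_1neq0.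

Definition padic_unit : pred Zp := fun x => `[< exists y : Zp, y * x = 1 >].
Definition padic_inv (x : Zp) : Zp :=
  if pselect (exists y : Zp, y * x = 1) is left ex then projT1 (cid ex) else x.

Fact padic_mulV : {in padic_unit, left_inverse 1 padic_inv *%R}.
Proof.
move=> x /asboolP ux; rewrite /padic_inv; case: pselect => // ex.
exact: projT2 (cid ex).
Qed.
Fact padic_unitP (x y : Zp) : y * x = 1 -> padic_unit x.
Proof. by move=> yx; apply/asboolP; exists y. Qed.
Fact padic_inv_out : {in [predC padic_unit], padic_inv =1 id}.
Proof.
move=> x /negP nux; rewrite /padic_inv; case: pselect => // ex.
by case: nux; apply/asboolP.
Qed.

HB.instance Definition _ := GRing.ComNzRing_hasMulInverse.Build Zp
  padic_mulV padic_unitP padic_inv_out.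

Lemma padic_lift x m n : (m <= n)%N -> (x n : nat)%:R = x m :> 'Z_(p ^ m.+1).
Proof.
elim: n => [|n IHn]; first by rewrite leqn0 => /eqP ->; apply: natr_Zp.
rewrite leq_eqVlt => /predU1P[->|lt_mn]; first exact: natr_Zp.
rewrite -(IHn lt_mn) -(padic_compat x n); apply: Zpow_eqP.
by rewrite val_Zp_nat ?ppow_gt1 // modn_dvdm // dvdn_exp2l // ltnS.
Qed.

Lemma padic_neq0 x m n : (m <= n)%N -> x m != 0 -> ~~ (p ^ m.+1 %| x n)%N.
Proof.
move=> le_mn; rewrite -(padic_lift x le_mn) -[0]/(0%:R) Zpow_eq mod0n.
by rewrite /dvdn.
Qed.

Fact padic_idomain : GRing.integral_domain_axiom Zp.
Proof.
move=> x y xy0; apply: contrapT => /negP; rewrite negb_or.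
have nz z : z != 0 -> exists n, z n != 0.
  move=> z0; apply: contrapT => nex; case/eqP: z0; apply: padic_intP => n.
  by apply/eqP; apply: contrapT => zn; apply: nex; exists n; apply/negP.
case/andP => /nz[m xm] /nz[n yn].
have := congr1 (fun z : Zp => z (m + n).+1) xy0.
rewrite -[LHS]/(x _ * y _) => /eqP.
have := padic_neq0 (leqW (leq_addr n m)) xm.
have := padic_neq0 (leqW (leq_addl m n)) yn.
set a := x _; set b := y _; rewrite -(natr_Zp a) -(natr_Zp b) => nb na.
rewrite -natrM -[_ == _]/(_ == 0%:R) Zpow_eq mod0n -/(dvdn _ _).
move: nb na; rewrite !natr_Zp; move: (a : nat) (b : nat) => {}a {}b nb na.
have a0 : (0 < a)%N by case: a na => //; rewrite dvdn0.
have b0 : (0 < b)%N by case: b nb => //; rewrite dvdn0.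
move: na nb; rewrite !pfactor_dvdn ?muln_gt0 ?a0 // lognM // -!leqNgt => la lb.
by move=> /(leq_trans (leqW (leqnn _))); rewrite ltnNge (leq_add la lb).
Qed.

HB.instance Definition _ :=
  GRing.ComUnitRing_isIntegral.Build Zp padic_idomain.

End PadicInt.

(** [Q_p], the field of fractions of [Z_p]. *)
Notation padic_num p_pr := {fraction (padic_int p_pr)}.

Section Integers.
Variables (p : nat) (p_pr : prime p) (K : fieldExtType (padic_num p_pr)).

Definition padic_int_in : {rmorphism padic_int p_pr -> K} :=
  (in_alg K \o @tofrac (padic_int p_pr))%FUN.

Definition integers : {pred K} := fun x => `[< integralOver padic_int_in x >].

Fact integers_subring : subring_closed integers.
Proof.
split=> [|x y /asboolP Ox /asboolP Oy|x y /asboolP Ox /asboolP Oy];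
  apply/asboolP.
- exact: integral1.
- exact: integral_sub.
- exact: integral_mul.
Qed.
HB.instance Definition _ :=
  GRing.isSubringClosed.Build K integers integers_subring.

(** [O_K], the integral closure of [Z_p] in [K]. *)
Record int_ring := IntRing { int_val :> K; int_valP : int_val \in integers }.

HB.instance Definition _ := [isSub for int_val].
HB.instance Definition _ := [Choice of int_ring by <:].
HB.instance Definition _ := [SubChoice_isSubComNzRing of int_ring by <:].

End Integers.

(** The sets [x + p^i S] form a fundamental system of neighborhoods of [x]. *)
Definition padic_nbhs (p : nat) (V : zmodType) (S : {pred V}) (x : V) :
    set_system V :=
  filter_from setT
    (fun i : nat => [set x + z *+ p ^ i | z in [set z | z \in S]])%classic.

Section PadicNbhs.
Local Open Scope classical_set_scope.
Variables (p : nat) (V : zmodType) (S : {pred V}) (S_zmod : zmod_closed S).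
Implicit Types (x : V) (A : set V).

Let zS : zmodClosed V := HB.pack S (GRing.isZmodClosed.Build V S S_zmod).

Lemma padic_nbhs_filter x : ProperFilter (padic_nbhs p S x).
Proof.
apply: filter_from_proper; last first.
  by move=> i _; exists x; exists 0; rewrite ?mul0rn ?addr0 //; apply: (@rpred0 _ zS).
apply: filter_from_filter; first by exists 0%N.
move=> i j _ _; exists (i + j)%N => // _ [z Sz <-]; split.
- by exists (z *+ p ^ j); rewrite -?mulrnA ?expnD 1?mulnC // /=; apply: (@rpredMn _ zS).
- by exists (z *+ p ^ i); rewrite -?mulrnA ?expnD // /=; apply: (@rpredMn _ zS).
Qed.

Lemma padic_nbhs_singleton x A : padic_nbhs p S x A -> A x.
Proof.
case=> i _; apply; exists 0; rewrite ?mul0rn ?addr0 //; exact: (@rpred0 _ zS).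
Qed.

Lemma padic_nbhs_nbhs x A :
  padic_nbhs p S x A -> padic_nbhs p S x (padic_nbhs p S ^~ A).
Proof.
case=> i _ sA; exists i => // _ [z Sz <-]; exists i => // _ [t St <-].
apply: sA; exists (z + t); first exact: (@rpredD _ zS).
by rewrite mulrnDl addrA.
Qed.

End PadicNbhs.

(** A copy of [K], carrying the p-adic topology: the [p^i O_K] form a
    fundamental system of neighborhoods of [0]. *)
Definition padic_field (p : nat) (p_pr : prime p)
  (K : fieldExtType (padic_num p_pr)) : Type := K.

Section PadicField.
Variables (p : nat) (p_pr : prime p) (K : fieldExtType (padic_num p_pr)).
Local Notation Kp := (padic_field K).
Local Notation OK := (@integers p p_pr K).

HB.instance Definition _ := GRing.Field.on Kp.

Fact integers_zmod : zmod_closed OK.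
Proof. exact: GRing.subring_closedB (integers_subring K). Qed.

HB.instance Definition _ := hasNbhs.Build Kp (@padic_nbhs p K OK).
HB.instance Definition _ := Nbhs_isNbhsTopological.Build Kp
  (padic_nbhs_filter p integers_zmod) (@padic_nbhs_singleton p K OK integers_zmod)
  (@padic_nbhs_nbhs p K OK integers_zmod).

End PadicField.

(** A copy of the [Z_p]-module [G], carrying the group topology in which the
    [p^i G] form a fundamental system of neighborhoods of [0]. *)
Definition padic_module (p : nat) (p_pr : prime p)
  (G : lmodType (padic_int p_pr)) : Type := G.

Section PadicModule.
Variables (p : nat) (p_pr : prime p) (G : lmodType (padic_int p_pr)).
Local Notation Gp := (padic_module G).
Let all_zmod : zmod_closed (predT : {pred G}). Proof. by []. Qed.

HB.instance Definition _ := GRing.Lmodule.on Gp.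
HB.instance Definition _ := hasNbhs.Build Gp (@padic_nbhs p G predT).
HB.instance Definition _ := Nbhs_isNbhsTopological.Build Gp
  (padic_nbhs_filter p all_zmod) (@padic_nbhs_singleton p G predT all_zmod)
  (@padic_nbhs_nbhs p G predT all_zmod).

End PadicModule.

Definition fin_gen (R : pzRingType) (G : lmodType R) : Prop :=
  exists (n : nat) (g : 'I_n -> G),
    forall x : G, exists c : 'I_n -> R, x = \sum_(i < n) c i *: g i.

Definition nonzero_vec (F : fieldType) : set 'rV[F]_3 := [set v | v != 0]%classic.

Section ProjPlane.
Variable F : fieldType.
Local Notation V := (set_type (@nonzero_vec F)).

Definition proportional (v w : V) : bool := (set_val v == set_val w)%MS.

Fact proportional_refl : reflexive proportional.
Proof. by move=> v; apply/eqmxP. Qed.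
Fact proportional_sym : symmetric proportional.
Proof. by move=> v w; rewrite /proportional andbC. Qed.
Fact proportional_trans : transitive proportional.
Proof.
move=> v u w /eqmxP uv /eqmxP vw; apply/eqmxP.
exact: eqmx_trans uv vw.
Qed.

Canonical proportional_equiv :=
  EquivRel proportional proportional_refl proportional_sym proportional_trans.

(** [P^2(F)]: two nonzero row vectors are identified when they span the same
    line. *)
Definition proj_plane : quotType V := {eq_quot proportional}%qT.

Definition proj_point (v : 'rV[F]_3) (v0 : v != 0) : proj_plane :=
  \pi_proj_plane%qT (exist _ v (mem_set v0) : V).

(** [hcoords P v]: [v] is a nonzero vector of homogeneous coordinates of [P]. *)
Definition hcoords (P : proj_plane) (v : 'rV[F]_3) : Prop :=
  exists v0 : v != 0, P = proj_point v0.
End ProjPlane.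

(** [P^2(K)], with the quotient topology of the topology of [K^3 \ {0}]. *)
Definition padic_plane (p : nat) (p_pr : prime p)
    (K : fieldExtType (padic_num p_pr)) : topologicalType :=
  quotient_topology (proj_plane (padic_field K)).

Record weierstrass (R : Type) :=
  Weierstrass { wa1 : R; wa2 : R; wa3 : R; wa4 : R; wa6 : R }.

Definition wmap (R S : Type) (f : R -> S) (W : weierstrass R) : weierstrass S :=
  Weierstrass (f (wa1 W)) (f (wa2 W)) (f (wa3 W)) (f (wa4 W)) (f (wa6 W)).

Definition vec3 (R : Type) (x y z : R) : 'rV[R]_3 :=
  \row_i nth x [:: x; y; z] i.

Definition wpoly (R : comNzRingType) (W : weierstrass R) (v : 'rV[R]_3) : R :=
  let X := v 0 0 in let Y := v 0 1 in let Z := v 0 2 in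
  Y ^+ 2 * Z + wa1 W * X * Y * Z + wa3 W * Y * Z ^+ 2
  - (X ^+ 3 + wa2 W * X ^+ 2 * Z + wa4 W * X * Z ^+ 2 + wa6 W * Z ^+ 3).

Section Geometry.
Variables (F : fieldType) (W : weierstrass F).
Implicit Types v w : 'rV[F]_3.

(** The equation at [v + t w], as a polynomial in [t]: the coefficient of [t] is
    the derivative of the equation at [v] in the direction [w]. *)
Definition wline v w : {poly F} :=
  wpoly (wmap polyC W) (map_mx polyC v + 'X *: map_mx polyC w).

Definition singular_point v : Prop :=
  [/\ v != 0, wpoly W v = 0 & forall i, (wline v (delta_mx 0 i))`_1 = 0].

Definition nonsingular_point v : Prop :=
  [/\ v != 0, wpoly W v = 0 & ~ singular_point v].

(** When [v] is a singular point, the line through [v] and [w] is tangent to the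
    curve at [v] when its intersection multiplicity with the curve at [v] is at
    least 3, i.e. when the quadratic term of the expansion at [v] vanishes. *)
Definition tangent_line v w : Prop :=
  ~~ (w <= v)%MS /\ (wline v w)`_2 = 0.

Definition cusp v : Prop :=
  singular_point v /\
  exists2 w, tangent_line v w &
    forall w', tangent_line v w' -> (w' <= v + w)%MS.

End Geometry.

(** Smoothness and cuspidality are geometric: points are taken with coordinates
    in arbitrary extensions of the base field. *)
Definition smooth_curve (F : fieldType) (W : weierstrass F) : Prop :=
  forall (L : fieldType) (i : {rmorphism F -> L}) (v : 'rV[L]_3),
    ~ singular_point (wmap i W) v.

Definition cuspidal_curve (F : fieldType) (W : weierstrass F) : Prop :=
  exists (L : fieldType) (i : {rmorphism F -> L}) (v : 'rV[L]_3),
    cusp (wmap i W) v.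

Section GroupLaw.
Variables (F : fieldType) (W : weierstrass F).

Fact vec3_aff_neq0 (x y : F) : vec3 x y 1 != 0.
Proof.
by apply/eqP => /rowP /(_ 2) /eqP; rewrite !mxE /= oner_eq0.
Qed.

Fact vec3_inf_neq0 : vec3 0 1 0 != 0 :> 'rV[F]_3.
Proof.
by apply/eqP => /rowP /(_ 1) /eqP; rewrite !mxE /= oner_eq0.
Qed.

(** [Some (x, y)] stands for [(x : y : 1)] and [None] for the origin
    [(0 : 1 : 0)], which is the only point of the curve on the line [Z = 0]. *)
Definition of_affine (P : option (F * F)) : proj_plane F :=
  if P is Some (x, y) then proj_point (vec3_aff_neq0 x y)
  else proj_point vec3_inf_neq0.

Definition to_affine (P : proj_plane F) : option (F * F) :=
  let v := set_val (repr P) in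
  if v 0 2 == 0 then None else Some (v 0 0 / v 0 2, v 0 1 / v 0 2).

(** The chord-tangent law: [l] is the slope of the line through [P] and [Q], or
    of the tangent at [P] when [P = Q]. *)
Definition affine_add (P Q : option (F * F)) : option (F * F) :=
  match P, Q with
  | None, _ => Q
  | _, None => P
  | Some (x1, y1), Some (x2, y2) =>
    if (x1 == x2) && (y1 + y2 + wa1 W * x2 + wa3 W == 0) then None else
    let l :=
      if x1 == x2 then
        (3 * x1 ^+ 2 + 2 * wa2 W * x1 + wa4 W - wa1 W * y1)
          / (2 * y1 + wa1 W * x1 + wa3 W)
      else (y2 - y1) / (x2 - x1) in
    let x3 := l ^+ 2 + wa1 W * l - wa2 W - x1 - x2 in
    Some (x3, - (y1 + l * (x3 - x1)) - wa1 W * x3 - wa3 W)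
  end.

Definition curve_add (P Q : proj_plane F) : proj_plane F :=
  of_affine (affine_add (to_affine P) (to_affine Q)).

Definition on_curve (P : proj_plane F) : Prop :=
  exists2 v, hcoords P v & wpoly W v = 0.

End GroupLaw.

Section Reduction.
Variables (p : nat) (p_pr : prime p) (K : fieldExtType (padic_num p_pr)).
Variables (k : fieldType) (red : {rmorphism int_ring K -> k}).
Variable W : weierstrass (int_ring K).

Definition generic_fiber : weierstrass (padic_field K) :=
  wmap (@int_val p p_pr K) W.

Definition special_fiber : weierstrass k := wmap red W.

(** [E_0(K)]: a point of the generic fiber is reduced through homogeneous
    coordinates in [O_K] that do not all reduce to [0]. *)
Definition E0 : set (padic_plane K) :=
  [set P | on_curve generic_fiber P /\
    exists2 v : 'rV[int_ring K]_3,
      hcoords P (map_mx (@int_val p p_pr K) v) &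
      nonsingular_point special_fiber (map_mx red v)]%classic.

End Reduction.

(* Main.v *)
(* After an integral change of coordinates the special fiber is [Y^2 Z = X^3], so that the
   coefficients of the equation lie in the maximal ideal. Then [z = - x / y] is a bijection
   from [E_0(K)] to [O_K]: the equation determines [w = - 1 / y], and the slope of the
   chord or tangent in the [(z, w)]-plane is a fraction whose denominator is a unit, so
   the group law is given by one formula on all of [O_K]. It agrees with addition modulo
   the maximal ideal, and up to [t^2] on the multiples of [t]. Hence the multiples
   [p^i E_0(K)] and the balls around [0] define the same topology, the action of [Z]
   extends to [Z_p] by continuity, and representatives of [O_K] modulo powers of [p]
   generate [E_0(K)] by successive approximation. The facts needed about [O_K] come from
   the trace form, which bounds the denominators of integral elements in a basis of [K]. *)

From HB Require Import structures.
Require Import Defs.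
From mathcomp Require Import all_boot all_order all_algebra all_field.
From mathcomp Require Import generic_quotient.
From mathcomp Require Import all_classical topology.
From mathcomp Require Import ring zify.

Set Implicit Arguments.
Unset Strict Implicit.
Unset Printing Implicit Defensive.
Import GRing.Theory.
Local Open Scope ring_scope.

(** * The ring [Z_p] *)

(** Sizes in [O_K] are measured by divisibility by powers of [p], without a valuation or a
    uniformizer. The trace form encloses [O_K] between two free [Z_p]-lattices; completeness,
    separatedness and finiteness modulo [p^n] pass through that enclosure, and finiteness gives
    locality, a Hensel-type surjectivity and a perfect residue field. Perfectness brings the cusp,
    which is only given over some extension of [k], back to coordinates in [k] that can be lifted to
    [O_K]. The obstacle is ramification: an element of the maximal ideal is only nilpotent modulo
    [p]. The estimate modulo [t^2] is therefore stated for every [t]: with [t = z] in the maximal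
    ideal it brings points into the multiples of [p], and from there on, with [t = p^n],
    multiplication by [p] acts as on the additive group. Additive reduction enters by making [p]
    kill the group modulo the maximal ideal. The group axioms are not verified on the formula for
    the law on [O_K]: the chart is injective into the points over [K], where associativity of the
    chord-tangent law comes down to rational identities. *)

Definition divides (R : comNzRingType) (d x : R) : Prop := exists y, x = d * y.

Section Dvd.
Variable R : comNzRingType.
Implicit Types d e x y z : R.

Lemma divides0 d : divides d 0. Proof. by exists 0; rewrite mulr0. Qed.
Lemma dividesd d : divides d d. Proof. by exists 1; rewrite mulr1. Qed.
Lemma divides1 x : divides 1 x. Proof. by exists x; rewrite mul1r. Qed.
Lemma dividesD d x y : divides d x -> divides d y -> divides d (x + y).
Proof. by move=> [a ->] [b ->]; exists (a + b); rewrite mulrDr. Qed.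
Lemma dividesN d x : divides d x -> divides d (- x).
Proof. by move=> [a ->]; exists (- a); rewrite mulrN. Qed.
Lemma dividesB d x y : divides d x -> divides d y -> divides d (x - y).
Proof. by move=> dx dy; apply: dividesD => //; apply: dividesN. Qed.
Lemma dividesMr d x y : divides d x -> divides d (x * y).
Proof. by move=> [a ->]; exists (a * y); rewrite mulrA. Qed.
Lemma dividesMl d x y : divides d x -> divides d (y * x).
Proof. by rewrite mulrC; apply: dividesMr. Qed.
Lemma dividesM d e x y : divides d x -> divides e y -> divides (d * e) (x * y).
Proof. by move=> [a ->] [b ->]; exists (a * b); rewrite mulrACA. Qed.
Lemma divides_trans d e x : divides d e -> divides e x -> divides d x.
Proof. by move=> de [y ->]; apply: dividesMr. Qed.
Lemma dividesX d m n : (m <= n)%N -> divides (d ^+ m) (d ^+ n).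
Proof. by move=> le_mn; exists (d ^+ (n - m)); rewrite -exprD subnKC. Qed.
Lemma dividesXX d x n : divides d x -> divides (d ^+ n) (x ^+ n).
Proof. by move=> [y ->]; exists (y ^+ n); rewrite exprMn. Qed.
Lemma divides_sum d (I : finType) (f : I -> R) :
  (forall i, divides d (f i)) -> divides d (\sum_i f i).
Proof. by move=> df; apply: big_ind => //; [apply: divides0|apply: dividesD]. Qed.

Lemma divides_cauchy d (u : nat -> R) m n :
    (forall k, divides (d ^+ k) (u k.+1 - u k)) -> (m <= n)%N ->
  divides (d ^+ m) (u n - u m).
Proof.
move=> cu; elim: n => [|n IHn]; first by rewrite leqn0 => /eqP ->; rewrite subrr;
  apply: divides0.
rewrite leq_eqVlt => /predU1P[->|]; first by rewrite subrr; apply: divides0.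
rewrite ltnS => le_mn; rewrite -[u n.+1](subrK (u n)) -addrA; apply: dividesD.
  exact: divides_trans (dividesX d le_mn) (cu n).
exact: IHn.
Qed.

End Dvd.

Lemma rmorph_divides (R S : comNzRingType) (f : {rmorphism R -> S}) d x :
  divides d x -> divides (f d) (f x).
Proof. by move=> [y ->]; exists (f y); rewrite rmorphM. Qed.

Section PadicIntTheory.
Variables (p : nat) (p_pr : prime p).
Local Notation Zp := (padic_int p_pr).
Local Notation Qp := (padic_num p_pr).
Implicit Types x y z : Zp.

Lemma padicM x y n : (x * y) n = x n * y n. Proof. by []. Qed.
Lemma padicB x y n : (x - y) n = x n - y n. Proof. by []. Qed.

Lemma padic_nat k n : (k%:R : Zp) n = k%:R.
Proof. by elim: k => [|k IHk] //; rewrite -[k.+1]addn1 !natrD -IHk. Qed.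

Lemma padicX x k n : (x ^+ k) n = x n ^+ k.
Proof. by elim: k => [|k IHk] //; rewrite !exprS -IHk. Qed.

Lemma Zpow_eq0 n (a : nat) : (a%:R == 0 :> 'Z_(p ^ n.+1)) = (p ^ n.+1 %| a)%N.
Proof. by rewrite -[_ == _]/(_ == 0%:R) (Zpow_eq p_pr) mod0n. Qed.

Lemma padic_dvdP x n : x n = 0 <-> divides (p%:R ^+ n.+1) x.
Proof.
split=> [xn0|[y ->]]; last first.
  rewrite padicM padicX padic_nat -natrX; apply/eqP.
  by rewrite (_ : (_)%:R = 0) ?mul0r //; apply/eqP; rewrite Zpow_eq0.
have dx m : (p ^ n.+1 %| x (m + n.+1))%N.
  by rewrite -Zpow_eq0 padic_lift ?xn0 // addnS leqW ?leq_addl.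
(* Level [m + n + 1] has modulus [p^(m+n+2)]; dividing by [p^(n+1)] leaves a residue modulo
   [p^(m+1)]. *)
pose y m : 'Z_(p ^ m.+1) := (x (m + n.+1)%N %/ p ^ n.+1)%:R.
have yP m : (y m.+1 : nat)%:R = y m.
  rewrite -[LHS]/(Zpow_red (y m.+1)) /y (Zpow_red_nat p_pr).
  apply: (Zpow_eqP p_pr); apply/eqP.
  have p0 : (0 < p ^ n.+1)%N by rewrite expn_gt0 prime_gt0.
  rewrite -(eqn_pmul2r p0) !muln_modl -expnD !divnK //.
  have /eqP := padic_lift x (leqnSn (m + n.+1)).
  by rewrite -[X in _ == X]natr_Zp (Zpow_eq p_pr).
exists (@PadicInt p p_pr _ yP); apply: padic_intP => m.
rewrite padicM padicX padic_nat -natrX /= -natrM mulnC divnK //.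
by rewrite padic_lift // leq_addr.
Qed.

(** Each component is prime to [p], hence invertible, and uniqueness of inverses makes the
    componentwise inverses compatible. *)
Lemma padic_unitP x : x 0%N != 0 -> x \is a GRing.unit.
Proof.
move=> x0; have ux n : x n \is a GRing.unit.
  rewrite -[x n]natr_Zp unitZpE ?(ppow_gt1 p_pr) // coprimeXl // prime_coprime //.
  by rewrite -[p in (p %| _)%N]expn1 -Zpow_eq0 padic_lift.
have yP n : ((x n.+1)^-1 : nat)%:R = (x n)^-1 :> 'Z_(p ^ n.+1).
  apply: (mulrI (ux n)); rewrite divrr ?ux //.
  rewrite -{1}(padic_compat x n) -[LHS](Zpow_redM p_pr (x n.+1)).
  by rewrite divrr ?ux // (Zpow_red1 p_pr).
apply/asboolP; exists (@PadicInt p p_pr _ yP); apply: padic_intP => n.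
by rewrite padicM /= mulVr ?ux.
Qed.

Lemma padic_p_neq0 : p%:R != 0 :> Zp.
Proof.
apply/eqP => /(congr1 (fun x : Zp => x 1%N)) /eqP.
rewrite padic_nat Zpow_eq0 => /dvdn_leq; rewrite prime_gt0 // => /(_ isT).
by rewrite leqNgt -[X in (X < _)%N]expn1 ltn_exp2l ?prime_gt1.
Qed.

Lemma padic_natr_neq0 n : (0 < n)%N -> n%:R != 0 :> Zp.
Proof.
move=> n0; apply/eqP => /(congr1 (fun x : Zp => x n)) /eqP.
rewrite padic_nat Zpow_eq0 => /dvdn_leq => /(_ n0).
by rewrite leqNgt (leq_trans (ltn_expl n (prime_gt1 p_pr))) // leq_exp2l ?prime_gt1.
Qed.

Lemma padic_ppart x : x != 0 ->
  exists n y, x = p%:R ^+ n * y /\ y \is a GRing.unit.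
Proof.
move=> x0; have [n xn0] : exists n, x n != 0.
  apply: contrapT => nex; case/eqP: x0; apply: padic_intP => n.
  by apply/eqP; apply: contrapT => xn; apply: nex; exists n; apply/negP.
elim: n x x0 xn0 => [|n IHn] x x0 xn0.
  by exists 0%N, x; rewrite mul1r padic_unitP.
have [x00|/padic_unitP ux] := eqVneq (x 0%N) 0; last by exists 0%N, x; rewrite mul1r.
have /padic_dvdP [y xE] := x00; rewrite expr1 in xE.
have y0 : y != 0 by apply: contraNneq x0 => y0; rewrite xE y0 mulr0.
have yn : y n != 0.
  apply: contraNneq xn0 => /padic_dvdP [z yE]; apply/eqP/padic_dvdP.
  by exists z; rewrite xE yE mulrA -exprS.
by have [m [z [yE uz]]] := IHn y y0 yn; exists m.+1, z; rewrite xE yE exprS mulrA.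
Qed.

Lemma padic_complete (u : nat -> Zp) :
    (forall n, divides (p%:R ^+ n) (u n.+1 - u n)) ->
  exists l, forall n, divides (p%:R ^+ n) (l - u n).
Proof.
(* Component [n] is a residue modulo [p^(n+1)], which is constant along [u] from index [n + 1]
   on. *)
move=> cu; pose l n : 'Z_(p ^ n.+1) := u n.+1 n.
have lP n : (l n.+1 : nat)%:R = l n.
  rewrite /l (padic_compat (u n.+2) n); apply/eqP; rewrite -subr_eq0 -padicB.
  by apply/eqP/padic_dvdP.
exists (@PadicInt p p_pr _ lP) => -[|n]; first exact: divides1.
by apply/padic_dvdP; rewrite padicB /= subrr.
Qed.

Lemma padic_separated x : (forall n, divides (p%:R ^+ n) x) -> x = 0.
Proof. by move=> dx; apply: padic_intP => n; apply/padic_dvdP. Qed.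

Lemma padic_numP (a : Qp) : exists n x, a * p%:R ^+ n = tofrac x.
Proof.
have [x [y [y0 ->]]] : exists x y : Zp, y != 0 /\ a = tofrac x / tofrac y.
  elim/quotW: a => r; exists (frac r).1, (frac r).2.
  have d0 : (frac r).2 != 0 by case: r.
  split=> //; apply: (canRL (mulfK _)); first by rewrite tofrac_eq0.
  unlock tofrac; rewrite -[LHS]pi_mul; apply/eqmodP.
  by rewrite /= FracField.equivfE /FracField.mulf !numden_Ratio ?oner_eq0 ?mulr1 // mulrC.
have [n [z [-> uz]]] := padic_ppart y0; exists n, (x / z).
rewrite [tofrac (p%:R ^+ n * z)]rmorphM rmorphXn rmorph_nat invfM mulrA.
rewrite mulrAC mulfVK ?expf_neq0 //; last first.
  by rewrite -(rmorph_nat (@tofrac Zp)) tofrac_eq0 padic_p_neq0.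
by rewrite rmorphM rmorphV.
Qed.

End PadicIntTheory.

(** * Bounded denominators in [Q_p] *)

Section BoundedDenominators.
Variables (p : nat) (p_pr : prime p).
Local Notation Zp := (padic_int p_pr).
Local Notation Qp := (padic_num p_pr).
Implicit Types (a b : Qp) (j k : nat).

(** Stands for a lower bound [-j] on the valuation of [a], that is, [a] in [p^-j Z_p]. *)
Definition denom_bound j a := exists x : Zp, a * p%:R ^+ j = tofrac x.

Lemma padic_num_p_neq0 : p%:R != 0 :> Qp.
Proof. by rewrite -(rmorph_nat (@tofrac Zp)) tofrac_eq0 padic_p_neq0. Qed.

Lemma denom_bound_tofrac (x : Zp) : denom_bound 0 (tofrac x).
Proof. by exists x; rewrite mulr1. Qed.

Lemma denom_bound0 j : denom_bound j 0.
Proof. by exists 0; rewrite mul0r rmorph0. Qed.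

Lemma denom_boundD j a b :
  denom_bound j a -> denom_bound j b -> denom_bound j (a + b).
Proof. by move=> [x ax] [y ay]; exists (x + y); rewrite mulrDl ax ay rmorphD. Qed.

Lemma denom_boundN j a : denom_bound j a -> denom_bound j (- a).
Proof. by move=> [x ax]; exists (- x); rewrite mulNr ax rmorphN. Qed.

Lemma denom_boundM i j a b :
  denom_bound i a -> denom_bound j b -> denom_bound (i + j) (a * b).
Proof.
by move=> [x ax] [y ay]; exists (x * y); rewrite exprD mulrACA ax ay rmorphM.
Qed.

Lemma denom_bound_leq i j a : (i <= j)%N -> denom_bound i a -> denom_bound j a.
Proof.
move=> le_ij [x ax]; exists (x * p%:R ^+ (j - i)).
by rewrite rmorphM rmorphXn rmorph_nat /= -ax -mulrA -exprD subnKC.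
Qed.

Lemma denom_bound_sum j (I : finType) (f : I -> Qp) :
  (forall i, denom_bound j (f i)) -> denom_bound j (\sum_i f i).
Proof.
by move=> fj; apply: big_ind => //; [apply: denom_bound0|apply: denom_boundD].
Qed.

Lemma denom_bound_uniform (I : finType) (f : I -> Qp) :
  exists j, forall i, denom_bound j (f i).
Proof.
have /fin_all_exists [j jP] i : exists j, denom_bound j (f i) by apply: padic_numP.
exists (\max_i j i) => i; apply: denom_bound_leq (jP i).
exact: leq_bigmax.
Qed.

(** If [a] is [p^-d] times a unit with [d > 0], then [a^(j+1)] has denominator [p^(d(j+1))], and
    [d(j+1) > j]. *)
Lemma denom_bound_powers j a :
  (forall k, denom_bound j (a ^+ k)) -> exists x : Zp, a = tofrac x.
Proof.
move=> aj; have [n [x ax]] := padic_numP a.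
have pn0 m : p%:R ^+ m != 0 :> Qp by rewrite expf_neq0 ?padic_num_p_neq0.
have [x0|x0] := eqVneq x 0.
  exists 0; apply: (mulIf (pn0 n)); by rewrite ax x0 rmorph0 mul0r.
have [m [u [xE uu]]] := padic_ppart x0.
have [le_nm|lt_mn] := leqP n m.
  exists (p%:R ^+ (m - n) * u); apply: (mulIf (pn0 n)).
  by rewrite ax xE -{1}(subnK le_nm) exprD !rmorphM !rmorphXn rmorph_nat /=; ring.
have au : a * p%:R ^+ (n - m) = tofrac u.
  apply: (mulIf (pn0 m)); rewrite -mulrA -exprD subnK ?ax 1?ltnW // xE.
  by rewrite rmorphM rmorphXn rmorph_nat mulrC.
have [y ay] := aj j.+1; exfalso.
have : u ^+ j.+1 * p%:R ^+ j = y * p%:R ^+ ((n - m) * j.+1).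
  apply/eqP; rewrite -tofrac_eq !rmorphM !rmorphXn !rmorph_nat /= -ay -au; apply/eqP.
  by rewrite exprMn exprM; ring.
have [d ->] : exists d, ((n - m) * j.+1)%N = (d.+1 + j)%N.
  exists ((n - m).-1 * j.+1)%N; rewrite -{1}(@prednK (n - m)) ?subn_gt0 //.
  by rewrite mulSn addnC addSnnS.
have pj0 : p%:R ^+ j != 0 :> Zp by rewrite expf_neq0 ?padic_p_neq0.
rewrite exprD mulrA => /(mulIf pj0) /(congr1 (fun z : Zp => z 0%N)).
have [v uv] : exists v, v * u = 1.
  by exists u^-1; rewrite mulVr.
move=> e; have : divides (p%:R ^+ 1) (u ^+ j.+1).
  by apply/padic_dvdP; rewrite e; apply/padic_dvdP/dividesMl/dividesX.
move=> /(dividesMl (v ^+ j.+1)); rewrite -exprMn uv expr1n => /padic_dvdP /eqP.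
by rewrite -[_ == _]/((1%:R : 'Z_(p ^ 1)) == 0) (Zpow_eq0 p_pr 0 1) dvdn1 expn1 gtn_eqF
  ?prime_gt1.
Qed.

Lemma padic_num_natr_neq0 n : (0 < n)%N -> n%:R != 0 :> Qp.
Proof.
by move=> n0; rewrite -(rmorph_nat (@tofrac Zp)) tofrac_eq0 padic_natr_neq0.
Qed.

(* Lagrange interpolation at [0, .., n - 1]. *)
Lemma denom_bound_coef n : exists j, forall q : {poly Qp},
    (size q <= n)%N -> (forall c : nat, exists x : Zp, q.[c%:R] = tofrac x) ->
  forall i, denom_bound j q`_i.
Proof.
pose V := Vandermonde n (\row_(i < n) (i%:R : Qp)).
have V_unit : V \in unitmx.
  rewrite unitmxE det_Vandermonde unitfE; apply/prodf_neq0 => i _.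
  apply/prodf_neq0 => j lt_ij; rewrite !mxE -natrB 1?ltnW //.
  by rewrite padic_num_natr_neq0 ?subn_gt0.
have [j jP] := denom_bound_uniform (fun ij : 'I_n * 'I_n => invmx V ij.1 ij.2).
exists j => q sq qint i.
have [lt_in|le_ni] := ltnP i n; last by rewrite nth_default ?(leq_trans sq) //;
  apply: denom_bound0.
have qE : \row_(k < n) q`_k = \row_(k < n) q.[k%:R] *m invmx V.
  apply: (canRL (mulmxK V_unit)); apply/rowP => k; rewrite !mxE (horner_coef_wide _ sq).
  by apply: eq_bigr => l _; rewrite !mxE.
have := congr1 (fun u : 'rV_n => u 0 (Ordinal lt_in)) qE; rewrite !mxE /= => ->.
apply: denom_bound_sum => k; rewrite mxE -[j]add0n; apply: denom_boundM.
  by have [x ->] := qint k; apply: denom_bound_tofrac.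
exact: (jP (k, Ordinal lt_in)).
Qed.

End BoundedDenominators.

(** * The ring of integers as a lattice *)

Section IntegerLattice.
Variables (p : nat) (p_pr : prime p) (K : fieldExtType (padic_num p_pr)).
Local Notation Zp := (padic_int p_pr).
Local Notation Qp := (padic_num p_pr).
Local Notation O := (int_ring K).
Local Notation n := (\dim {:K}).
Local Notation e := (vbasis {:K}).
Implicit Types (x y z : K).

Definition mul_matrix x : 'M[Qp]_n := \matrix_(i, j) coord e i (x * e`_j).

Lemma coord_vbasisE x : x = \sum_(i < n) coord e i x *: e`_i.
Proof. exact: coord_vbasis (memvf x). Qed.

Lemma coord_sumE (c : 'I_n -> Qp) i : coord e i (\sum_(j < n) c j *: e`_j) = c i.
Proof. by rewrite coord_sum_free // (basis_free (vbasisP _)). Qed.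

Lemma mul_matrixE x (j : 'I_n) : x * e`_j = \sum_(i < n) mul_matrix x i j *: e`_i.
Proof. by rewrite {1}[x * _]coord_vbasisE; apply: eq_bigr => i _; rewrite mxE. Qed.

Lemma mul_matrixD x y : mul_matrix (x + y) = mul_matrix x + mul_matrix y.
Proof. by apply/matrixP => i j; rewrite !mxE mulrDl linearD. Qed.

Lemma mul_matrixZ c x : mul_matrix (c *: x) = c *: mul_matrix x.
Proof. by apply/matrixP => i j; rewrite !mxE -scalerAl linearZ. Qed.

Lemma mul_matrix0 : mul_matrix 0 = 0.
Proof. by apply/matrixP => i j; rewrite !mxE mul0r linear0. Qed.

Lemma mul_matrix_sum (I : finType) (f : I -> K) :
  mul_matrix (\sum_i f i) = \sum_i mul_matrix (f i).
Proof. exact: (big_morph _ mul_matrixD mul_matrix0). Qed.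

Lemma mul_matrix1 : mul_matrix 1 = 1%:M.
Proof.
apply/matrixP => i j; rewrite !mxE mul1r.
rewrite (_ : e`_j = \sum_(k < n) (k == j)%:R *: e`_k) ?coord_sumE //.
rewrite (bigD1 j) //= eqxx scale1r big1 ?addr0 // => k /negPf ->.
by rewrite scale0r.
Qed.

Lemma mul_matrixM x y : mul_matrix (x * y) = mul_matrix x *m mul_matrix y.
Proof.
apply/matrixP => i j; rewrite [LHS]mxE -mulrA mul_matrixE mulr_sumr mxE linear_sum.
apply: eq_bigr => k _ /=; rewrite -scalerAr linearZ /= mul_matrixE coord_sumE.
by rewrite mulrC.
Qed.

Lemma mul_matrixX x k : \det (mul_matrix (x ^+ k)) = \det (mul_matrix x) ^+ k.
Proof.
elim: k => [|k IHk]; first by rewrite mul_matrix1 det1.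
by rewrite !exprS mul_matrixM det_mulmx IHk.
Qed.

Lemma dim_gt0 : (0 < n)%N.
Proof. by rewrite lt0n dimv_eq0 -subv0; apply/subvPn; exists 1;
  rewrite ?memvf // memv0 oner_eq0. Qed.

Lemma vbasis_neq0 : exists j : 'I_n, e`_j != 0.
Proof.
exists (Ordinal dim_gt0); have /free_not0 := basis_free (vbasisP {:K}).
by apply; rewrite mem_nth // size_tuple dim_gt0.
Qed.

(** The row of basis vectors is an eigenvector with eigenvalue [x], so [x] is a root of the
    characteristic polynomial of [A], which is monic over [Z_p]. *)
Lemma integral_mul_matrix x (A : 'M[Zp]_n) :
  mul_matrix x = map_mx (@tofrac Zp) A -> x \in @integers p p_pr K.
Proof.
move=> xA; apply/asboolP; exists (char_poly A); first exact: char_poly_monic.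
rewrite map_char_poly -eigenvalue_root_char; apply/eigenvalueP.
exists (\row_j e`_j).
  apply/rowP => j; rewrite !mxE mul_matrixE xA; apply: eq_bigr => i _.
  by rewrite !mxE mulrC mulr_algl.
have [j ej] := vbasis_neq0; apply: contraNneq ej => /rowP/(_ j).
by rewrite !mxE => ->.
Qed.

Lemma denom_bound_mx m m' (A : 'M[Qp]_(m, m')) j :
  (forall i k, denom_bound j (A i k)) ->
  exists B : 'M[Zp]_(m, m'), p%:R ^+ j *: A = map_mx (@tofrac Zp) B.
Proof.
move=> Aj.
have /fin_all_exists [f fP] (ik : 'I_m * 'I_m') :
    exists x : Zp, A ik.1 ik.2 * p%:R ^+ j = tofrac x by apply: Aj.
by exists (\matrix_(i, k) f (i, k)); apply/matrixP => i k; rewrite !mxE mulrC (fP (i, k)).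
Qed.

Lemma mul_matrix_denom_bound x :
  exists j, forall i k, denom_bound j (mul_matrix x i k).
Proof.
have [j jP] := denom_bound_uniform (fun ik : 'I_n * 'I_n => mul_matrix x ik.1 ik.2).
by exists j => i k; apply: (jP (i, k)).
Qed.

Lemma integral_scale x : exists j, p%:R ^+ j *: x \in @integers p p_pr K.
Proof.
have [j /denom_bound_mx [A xA]] := mul_matrix_denom_bound x.
by exists j; apply: (@integral_mul_matrix _ A); rewrite mul_matrixZ.
Qed.

(** Dividing [X^k] by a monic equation of [x] leaves a remainder whose degree is bounded
    independently of [k]. *)
Lemma integral_powers x : x \in @integers p p_pr K ->
  exists m, forall k, exists c : 'I_m -> Zp, x ^+ k = \sum_(i < m) tofrac (c i) *: x ^+ i.
Proof.
move=> /asboolP [q q_mon qx]; exists (size q) => k.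
have [r sr rx] : exists2 r : {poly Zp}, (size r <= size q)%N &
    x ^+ k = (map_poly (@padic_int_in p p_pr K) r).[x].
  exists (Pdiv.Ring.rmodp 'X^k q).
    by rewrite ltnW // Pdiv.Ring.ltn_rmodpN0 ?monic_neq0.
  have /(congr1 (fun s => (map_poly (@padic_int_in p p_pr K) s).[x])) :=
    Pdiv.RingMonic.rdivp_eq q_mon 'X^k.
  by rewrite rmorphD rmorphM /= hornerD hornerM (rootP qx) mulr0 add0r map_polyXn
    hornerXn.
exists (fun i => r`_i); rewrite rx (@horner_coef_wide _ (size q)); last first.
  exact: leq_trans (size_poly _ _) sr.
by apply: eq_bigr => i _; rewrite coef_map /= mulr_algl.
Qed.

(* The powers of an integral [x] lie in a finitely generated [Z_p]-module, hence
   have bounded denominators, and so do the powers of the norm of [x]. *)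
Lemma integral_det x : x \in @integers p p_pr K ->
  exists a : Zp, \det (mul_matrix x) = tofrac a.
Proof.
move=> /integral_powers [m mP].
have [j jP] := denom_bound_uniform
  (fun u : 'I_m * ('I_n * 'I_n) => mul_matrix (x ^+ u.1) u.2.1 u.2.2).
have xj k i l : denom_bound j (mul_matrix (x ^+ k) i l).
  have [c ->] := mP k; rewrite mul_matrix_sum summxE; apply: denom_bound_sum => u.
  rewrite mul_matrixZ mxE -[j]add0n; apply: denom_boundM; last exact: (jP (u, (i, l))).
  exact: denom_bound_tofrac.
apply: (@denom_bound_powers _ _ (j * n)) => k; rewrite -mul_matrixX.
have [B kB] := denom_bound_mx (xj k).
exists (\det B); rewrite -det_map_mx -kB detZ exprM mulrC //.
Qed.

Lemma char_poly_horner x c :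
  (char_poly (mul_matrix x)).[c] = \det (mul_matrix (c%:A - x)).
Proof.
rewrite -horner_evalE -det_map_mx; congr (\det _); apply/matrixP => i j.
rewrite mul_matrixD mul_matrixZ mul_matrix1 -scaleN1r mul_matrixZ !mxE.
rewrite /= /horner_eval !hornerE hornerMn hornerX mulN1r.
by rewrite mulr_natr.
Qed.

(** At a natural number [c] the characteristic polynomial takes the norm of the integral element
    [c - x] as value. Interpolation at [n + 1] such points bounds all its coefficients, the trace
    among them, uniformly in [x]. *)
Lemma integral_trace : exists j, forall x, x \in @integers p p_pr K ->
  denom_bound j (\tr (mul_matrix x)).
Proof.
have [j jP] := denom_bound_coef p_pr n.+1; exists j => x Ox.
rewrite -[\tr _]opprK -char_poly_trace ?dim_gt0 //; apply: denom_boundN.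
apply: jP; first by rewrite size_char_poly.
move=> c; rewrite char_poly_horner; apply: integral_det.
rewrite scaler_nat; apply: rpredB => //; exact: rpred_nat.
Qed.

Definition trace_form : 'M[Qp]_n := \matrix_(i, j) \tr (mul_matrix (e`_i * e`_j)).

(* If [y] is in the kernel of the trace form, then [y = 0]: otherwise the trace
   of [y * y^-1 = 1] would be [0]. *)
Lemma trace_form_unit : trace_form \in unitmx.
Proof.
rewrite -row_free_unit -kermx_eq0; apply/rowV0P => u /sub_kermxP uT.
pose y := \sum_(i < n) u 0 i *: e`_i.
have trE (v : K) : \tr (mul_matrix (y * v)) = 0.
  rewrite [v]coord_vbasisE mulr_sumr mul_matrix_sum linear_sum big1 // => j _.
  rewrite -scalerAr mul_matrixZ linearZ /= mulr_suml mul_matrix_sum linear_sum /=.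
  rewrite (_ : \sum_i _ = (u *m trace_form) 0 j); first by rewrite uT mxE mulr0.
  rewrite mxE; apply: eq_bigr => i _; rewrite !mxE.
  by rewrite -scalerAl mul_matrixZ linearZ.
suff y0 : y = 0.
  by apply/rowP => i; rewrite mxE -[LHS](coord_sumE (fun k => u 0 k)) -/y y0 linear0.
apply/eqP; apply: contraT => y0; have := trE y^-1.
rewrite divff // mul_matrix1 mxtrace1 => /eqP.
by rewrite (negPf (padic_num_natr_neq0 _ _)) // dim_gt0.
Qed.

(** The coordinates of [x] are recovered from the traces of [x * e_j] by the inverse of the trace
    form. The three summands of the bound come from the traces, from making the [e_j] integral, and
    from that inverse matrix. *)
Lemma integral_coord : exists j, forall x, x \in @integers p p_pr K ->
  forall i, denom_bound j (coord e i x).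
Proof.
have [t tP] := integral_trace.
have /fin_all_exists [s sP] (i : 'I_n) := integral_scale e`_i.
have [r rP] := denom_bound_uniform (fun ij : 'I_n * 'I_n => invmx trace_form ij.1 ij.2).
exists ((t + \max_i s i) + r)%N => x Ox i.
have xE : \row_k coord e k x = \row_j \tr (mul_matrix (x * e`_j)) *m invmx trace_form.
  apply: (canRL (mulmxK trace_form_unit)); apply/rowP => j; rewrite !mxE.
  rewrite {2}[x]coord_vbasisE mulr_suml mul_matrix_sum linear_sum.
  by apply: eq_bigr => k _; rewrite !mxE -scalerAl mul_matrixZ linearZ.
have := congr1 (fun u : 'rV_n => u 0 i) xE; rewrite !mxE => ->.
apply: denom_bound_sum => j; rewrite mxE; apply: denom_boundM; last exact: (rP (j, i)).
apply: (@denom_bound_leq _ _ (t + s j)); first by rewrite leq_add2l (leq_bigmax j).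
have [a aE] := tP _ (rpredM Ox (sP j)).
exists a; rewrite -aE -scalerAr mul_matrixZ linearZ /= exprD; ring.
Qed.

Lemma int_val_inj : injective (@int_val p p_pr K).
Proof. exact: val_inj. Qed.

Lemma int_val_zmod : zmod_morphism (@int_val p p_pr K).
Proof. exact: (rmorphB (\val : {rmorphism O -> K})). Qed.
Lemma int_val_monoid : monoid_morphism (@int_val p p_pr K).
Proof.
split; first exact: (rmorph1 (\val : {rmorphism O -> K})).
exact: (rmorphM (\val : {rmorphism O -> K})).
Qed.
HB.instance Definition _ :=
  GRing.isZmodMorphism.Build O K (@int_val p p_pr K) int_val_zmod.
HB.instance Definition _ :=
  GRing.isMonoidMorphism.Build O K (@int_val p p_pr K) int_val_monoid.

Definition int_in (c : Zp) : O :=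
  @IntRing p p_pr K (padic_int_in K c)
    (introT (asboolP _) (integral_id (padic_int_in K) c)).

Lemma int_in_zmod : zmod_morphism int_in.
Proof. by move=> a b; apply: val_inj; apply: (rmorphB (padic_int_in K)). Qed.
Lemma int_in_monoid : monoid_morphism int_in.
Proof.
split=> [|a b]; apply: val_inj; first exact: (rmorph1 (padic_int_in K)).
exact: (rmorphM (padic_int_in K)).
Qed.
HB.instance Definition _ := GRing.isZmodMorphism.Build Zp O int_in int_in_zmod.
HB.instance Definition _ := GRing.isMonoidMorphism.Build Zp O int_in int_in_monoid.

(** [O_K] lies between the free module on [b] and [p^-N] times it. Through this enclosure
    completeness, separatedness and finiteness are inherited from [Z_p]. *)
Lemma int_lattice : exists m (b : 'I_m -> O) N,
  (forall x : O, exists c : 'I_m -> Zp, p%:R ^+ N * x = \sum_i int_in (c i) * b i) /\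
  (forall c : 'I_m -> Zp, \sum_i int_in (c i) * b i = 0 -> forall i, c i = 0).
Proof.
have /fin_all_exists [s sP] (i : 'I_n) := integral_scale e`_i.
have [r rP] := integral_coord.
pose b i : O := IntRing (sP i).
have valS (c : 'I_n -> Zp) :
    int_val (\sum_i int_in (c i) * b i) = \sum_(i < n) (tofrac (c i) * p%:R ^+ s i) *:
      e`_i.
  rewrite rmorph_sum; apply: eq_bigr => i _.
  by rewrite rmorphM /= mulr_algl scalerA.
exists n, b, (r + \max_i s i)%N; split=> [x|c /(congr1 (@int_val p p_pr K)) c0 i].
  have /fin_all_exists [c cP] (i : 'I_n) : exists a : Zp,
      coord e i (int_val x) * p%:R ^+ r = tofrac a by apply: rP; apply: int_valP.
  exists (fun i => c i * p%:R ^+ (\max_i s i - s i)); apply: int_val_inj.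
  rewrite valS rmorphM rmorphXn rmorph_nat /= {1}[int_val x]coord_vbasisE mulr_sumr.
  apply: eq_bigr => i _; rewrite rmorphM rmorphXn rmorph_nat /= -cP.
  rewrite -mulrA -exprD subnK ?(leq_bigmax i) //.
  by rewrite -natrX mulr_natl -scaler_nat scalerA natrX exprD mulrC mulrA.
move: c0; rewrite valS => /(congr1 (coord e i)); rewrite coord_sumE rmorph0 linear0.
move=> /eqP; rewrite mulf_eq0 expf_eq0 (negPf (padic_num_p_neq0 p_pr)) andbF orbF.
by rewrite tofrac_eq0 => /eqP.
Qed.

End IntegerLattice.

(** * The ring of integers as a local ring *)

Lemma pigeonhole (T : finType) (f : nat -> T) : exists i d, f (i + d.+1)%N = f i.
Proof.
pose g (i : 'I_#|T|.+1) := f i.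
have /injectivePn [i [j ne_ij gij]] : ~~ injectiveb g.
  by apply/negP => /injectiveP /leq_card; rewrite card_ord ltnn.
wlog lt_ij : i j ne_ij gij / (i < j)%N.
  move=> H; have [lt|lt|e] := ltngtP i j; first exact: (H i j).
    by apply: (H j i) => //; rewrite eq_sym.
  by case/eqP: ne_ij; apply: val_inj.
by exists i, (j - i).-1; rewrite prednK ?subn_gt0 // subnKC 1?ltnW.
Qed.

Section IntegerRing.
Variables (p : nat) (p_pr : prime p) (K : fieldExtType (padic_num p_pr)).
Local Notation Zp := (padic_int p_pr).
Local Notation O := (int_ring K).
Implicit Types (x y z : O) (n : nat).

Lemma field_p_neq0 : p%:R != 0 :> K.
Proof. by rewrite -(rmorph_nat (in_alg K)) fmorph_eq0 padic_num_p_neq0. Qed.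

Lemma int_mul_eq0 x y : x * y = 0 -> x = 0 \/ y = 0.
Proof.
move=> /(congr1 (@int_val p p_pr K)) /eqP; rewrite rmorphM rmorph0 mulf_eq0.
by case/orP => /eqP e; [left|right]; apply: int_val_inj; rewrite e rmorph0.
Qed.

Lemma int_mulpI n x y : p%:R ^+ n * x = p%:R ^+ n * y -> x = y.
Proof.
move=> /(congr1 (@int_val p p_pr K)); rewrite !rmorphM !rmorphXn !rmorph_nat.
by move=> /(mulfI (expf_neq0 n field_p_neq0)) /int_val_inj.
Qed.

Lemma int_separated x : (forall n, divides (p%:R ^+ n) x) -> x = 0.
Proof.
move=> dx; have [m [b [N [bN bfree]]]] := int_lattice K.
have [c xc] := bN x; apply: (@int_mulpI N); rewrite mulr0 xc big1 // => i _.
rewrite (padic_separated (x := c i)) ?rmorph0 ?mul0r // => n.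
have [y xy] := dx n; have [c' yc'] := bN y.
have /bfree/(_ i)/eqP : \sum_i int_in K (c i - p%:R ^+ n * c' i) * b i = 0.
  under eq_bigr => j _ do rewrite rmorphB rmorphM rmorphXn rmorph_nat mulrBl -mulrA.
  by rewrite sumrB -mulr_sumr -yc' -xc xy mulrCA subrr.
by rewrite subr_eq0 => /eqP ->; exists (c' i).
Qed.

Lemma int_eq_separated x y : (forall n, divides (p%:R ^+ n) (x - y)) -> x = y.
Proof. by move=> dxy; apply/eqP; rewrite -subr_eq0; apply/eqP/int_separated. Qed.

Lemma int_complete (u : nat -> O) :
    (forall n, divides (p%:R ^+ n) (u n.+1 - u n)) ->
  exists l, forall n, divides (p%:R ^+ n) (l - u n).
Proof.
move=> cu; have [v uv] := choice cu.
have [m [b [N [bN _]]]] := int_lattice K.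
have [c vc] := choice (fun n => bN (v n)).
(* Only multiples of [p^N] have coordinates, so the telescoping sum starts at index [N]: there the
   differences [p^(N+n) * v (N+n)] carry the factor [p^N] that [v] needs. *)
pose S i k : Zp := \sum_(n < k) p%:R ^+ n * c (n + N)%N i.
have /fin_all_exists [l lS] i : exists l, forall k, divides (p%:R ^+ k) (l - S i k).
  apply: padic_complete => k; rewrite /S big_ord_recr /= addrAC subrr add0r.
  exact/dividesMr/dividesd.
have uN k : u (N + k)%N = u N + \sum_i int_in K (S i k) * b i.
  elim: k => [|k IHk].
    by rewrite addn0 big1 ?addr0 // => i _; rewrite /S big_ord0 rmorph0 mul0r.
  rewrite addnS -[LHS](subrK (u (N + k)%N)) uv IHk addrCA; congr (_ + _).
  rewrite exprD mulrAC vc mulr_suml -big_split /=; apply: eq_bigr => i _.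
  by rewrite /S big_ord_recr /= rmorphD rmorphM rmorphXn rmorph_nat [(k + N)%N]addnC;
    ring.
exists (u N + \sum_i int_in K (l i) * b i) => n.
set L := (X in divides _ (X - _)); have ->
  : L - u n = (L - u (N + n)%N) + (u (N + n)%N - u n) by ring.
apply: dividesD; last by apply: divides_cauchy => //; apply: leq_addl.
rewrite uN /L opprD addrACA subrr add0r -sumrB; apply: divides_sum => i.
rewrite -mulrBl -rmorphB; apply: dividesMr.
by have := rmorph_divides (int_in K) (lS i n); rewrite rmorphXn rmorph_nat.
Qed.

Lemma int_finite n : exists (T : finType) (cl : O -> T),
  forall x y, cl x = cl y -> divides (p%:R ^+ n) (x - y).
Proof.
have [m [b [N [bN _]]]] := int_lattice K; have [c xc] := choice bN.
(* The coordinates are those of [p^N x], so [N] further digits are compared, to be lost when [p^N]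
   is cancelled. *)
exists {ffun 'I_m -> 'Z_(p ^ (N + n).+1)}, (fun x => [ffun i => c x i (N + n)%N]).
move=> x y /ffunP cxy.
have /fin_all_exists [d dP] i : divides (p%:R ^+ (N + n).+1) (c x i - c y i).
  by apply/padic_dvdP; rewrite padicB; apply/eqP; rewrite subr_eq0; have:= cxy i;
    rewrite !ffunE => ->.
exists (p%:R * \sum_i int_in K (d i) * b i); apply: (@int_mulpI N).
rewrite mulrBr (xc x) (xc y) -sumrB !mulrA -exprD -exprSr mulr_sumr;
  apply: eq_bigr => i _.
by rewrite -mulrBl -rmorphB dP rmorphM rmorphXn rmorph_nat mulrA.
Qed.

Lemma int_pigeonhole n (u : nat -> O) :
  exists i d, divides (p%:R ^+ n) (u (i + d.+1)%N - u i).
Proof.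
have [T [cl clP]] := int_finite n; have [i [d e]] := pigeonhole (cl \o u).
by exists i, d; apply: clP.
Qed.

Lemma int_residues n : exists (T : finType) (r : T -> O),
  forall x, exists t, divides (p%:R ^+ n) (x - r t).
Proof.
have [T [cl clP]] := int_finite n.
have /fin_all_exists [r rP] (t : T) : exists r, forall x, cl x = t -> cl r = t.
  have [[x xt]|nx] := pselect (exists x, cl x = t); first by exists x.
  by exists 0 => x xt; case: nx; exists x.
exists T, r => x; exists (cl x); apply: clP; by rewrite (rP _ x).
Qed.

Lemma int_unit_1p x : exists y, (1 + p%:R * x) * y = 1.
Proof.
(* Partial sums of the geometric series for the inverse of [1 + p x]. *)
pose u n : O := \sum_(k < n) (- (p%:R * x)) ^+ k.
have [|l lu] := @int_complete u.
  move=> n; rewrite /u big_ord_recr /= addrAC subrr add0r.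
  exact/dividesXX/dividesN/dividesMr/dividesd.
exists l; apply: int_eq_separated => n.
have -> : (1 + p%:R * x) * l - 1 =
    (1 + p%:R * x) * (l - u n) + ((1 + p%:R * x) * u n - 1) by ring.
apply: dividesD; first exact/dividesMl.
have -> : (1 + p%:R * x) * u n - 1 = - (- (p%:R * x)) ^+ n.
  have := subrX1 (- (p%:R * x)) n; rewrite -/(u n) => e.
  have -> : (1 + p%:R * x) * u n = - ((- (p%:R * x) - 1) * u n) by ring.
  by rewrite -e; ring.
exact/dividesN/dividesXX/dividesN/dividesMr/dividesd.
Qed.

(* The iteration [y |-> 3 y^2 - 2 y^3] lifts idempotents, and [O] is a domain. *)
Lemma int_idempotent x : divides p%:R (x ^+ 2 - x) ->
  divides p%:R x \/ divides p%:R (x - 1).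
Proof.
move=> dx; pose u n := iter n (fun y : O => 3 * y ^+ 2 - 2 * y ^+ 3) x.
have du n : divides (p%:R ^+ n.+1) (u n ^+ 2 - u n).
  elim: n => [|n IHn]; first by rewrite expr1.
  rewrite /u iterS -/(u n); set y := u n in IHn *.
  have -> : (3 * y ^+ 2 - 2 * y ^+ 3) ^+ 2 - (3 * y ^+ 2 - 2 * y ^+ 3) =
    (y ^+ 2 - y) ^+ 2 * ((2 * y - 3) * (2 * y + 1)) by ring.
  apply/dividesMr; have := dividesXX 2 IHn; apply: divides_trans.
  by rewrite -exprM; apply: dividesX; rewrite muln2 -addnn addSn ltnS addnS ltnS leq_addr.
have cu n : divides (p%:R ^+ n.+1) (u n.+1 - u n).
  rewrite /u iterS -/(u n); set y := u n.
  have -> : 3 * y ^+ 2 - 2 * y ^+ 3 - y = (y ^+ 2 - y) * (1 - 2 * y) by ring.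
  exact/dividesMr/du.
have [|l lu] := @int_complete u.
  by move=> n; apply: divides_trans (cu n); apply: dividesX.
have : l * (l - 1) = 0.
  apply: int_separated => n; have du' := divides_trans (dividesX _ (leqnSn n)) (du n).
  have := lu n; move: du'; set y := u n => dy dl.
  have -> : l * (l - 1) = (y ^+ 2 - y) + (l - y) * (l + y - 1) by ring.
  by apply: dividesD => //; apply: dividesMr.
have xl : divides p%:R (x - l).
  have := lu 1%N; have := cu 0%N; rewrite !expr1 => d1 d2.
  rewrite -[x]/(u 0%N); move: (u 0%N) (u 1%N) d1 d2 => y z d1 d2.
  have -> : y - l = - (z - y) - (l - z) by ring.
  by apply: dividesB => //; apply: dividesN.
case/int_mul_eq0 => [l0|/eqP]; first by left; rewrite l0 subr0 in xl.
by rewrite subr_eq0 => /eqP l1; right; rewrite l1 in xl.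
Qed.

Lemma int_power_idempotent x :
  exists N, divides p%:R ((x ^+ N.+1) ^+ 2 - x ^+ N.+1).
Proof.
have [i [d]] := int_pigeonhole 1 (fun k => x ^+ k); rewrite expr1 => dxd.
have step k : divides p%:R (x ^+ (i + k * d.+1)%N - x ^+ i).
  elim: k => [|k IHk]; first by rewrite addn0 subrr; apply: divides0.
  rewrite mulSn addnA exprD.
  have -> : x ^+ (i + d.+1)%N * x ^+ (k * d.+1) - x ^+ i =
    (x ^+ (i + d.+1)%N - x ^+ i) * x ^+ (k * d.+1) + (x ^+ (i + k * d.+1)%N - x ^+ i).
    by rewrite mulrBl (exprD x i (k * d.+1)) addrA subrK.
  by apply: dividesD => //; apply: dividesMr.
(* Modulo [p] the powers of [x] have period [d + 1] from exponent [i] on; an exponent that is a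
   multiple of the period and at least [i] gives an idempotent. *)
have [N NE] : exists N, N.+1 = (i.+1 * d.+1)%N by exists (i.+1 * d.+1).-1.
exists N; have [M ME] : exists M, N.+1 = (M + i)%N.
  by exists (N.+1 - i)%N; rewrite subnK // NE (leq_trans (leqnSn i)) // leq_pmulr.
have -> : (x ^+ N.+1) ^+ 2 - x ^+ N.+1 = x ^+ M * (x ^+ (i + i.+1 * d.+1)%N - x ^+ i).
  rewrite mulrBr -!exprD -ME addnA -ME -NE -exprM.
  by rewrite muln2 -addnn.
exact: dividesMl.
Qed.

(** Some power of [x] is idempotent modulo [p], hence congruent to 0 or to 1; in the second case it
    has the form [1 + p z], which is a unit. *)
Lemma int_local x : (exists N, divides p%:R (x ^+ N.+1)) \/ exists y, x * y = 1.
Proof.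
have [N /int_idempotent[dx|[z xz]]] := int_power_idempotent x; first by left; exists N.
right; have [y zy] := int_unit_1p z; exists (x ^+ N * y).
by rewrite mulrA -exprS -zy; congr (_ * _); rewrite -xz; ring.
Qed.

(* A Hensel lemma obtained by counting: modulo [p ^+ n] the iterates of [g] on [t] are
   periodic, and [g] is injective, so that [t] is itself a value of [g]. *)
Lemma int_surj (g : O -> O) :
    (forall x y, exists u v, u * v = 1 /\ g x - g y = (x - y) * u) ->
  forall t, exists x, g x = t.
Proof.
move=> gP t; have g_dvd n x y : divides (p%:R ^+ n) (g x - g y) <->
    divides (p%:R ^+ n) (x - y).
  have [u [v [uv gxy]]] := gP x y; rewrite gxy; split; last exact: dividesMr.
  by move/(dividesMr v); rewrite -mulrA uv mulr1.
have it_dvd n i x y : divides (p%:R ^+ n) (iter i g x - iter i g y) ->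
    divides (p%:R ^+ n) (x - y).
  by elim: i => // i IHi /= /g_dvd /IHi.
have /choice [x xP] n : exists x, divides (p%:R ^+ n) (g x - t).
  have [i [d]] := int_pigeonhole n (fun i => iter i g t).
  by rewrite iterD => /it_dvd; exists (iter d g t).
have [|l lx] := @int_complete x.
  move=> n; apply/g_dvd; rewrite -[g _](subrK t) -addrA; apply: dividesD.
    exact: divides_trans (dividesX _ (leqnSn n)) (xP n.+1).
  by rewrite -opprB; apply: dividesN.
exists l; apply: int_eq_separated => n.
rewrite -[g l](subrK (g (x n))) -addrA; apply: dividesD => //.
exact/g_dvd.
Qed.

(** * The residue field *)

Variables (k : fieldType) (red : {rmorphism O -> k}).
Hypothesis red_surj : forall a : k, exists x, red x = a.

(** Otherwise, for [y] lifting the inverse of [red p], the unit [1 - p y] would reduce to 0. *)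
Lemma red_p : red p%:R = 0.
Proof.
apply/eqP; apply: contraT => rp0; have [y ry] := red_surj (red p%:R)^-1.
have [z /(congr1 red)] := int_unit_1p (- y).
rewrite rmorphM rmorphD rmorphM rmorphN ry rmorph1 mulrN divff // subrr mul0r.
by move/eqP; rewrite eq_sym oner_eq0.
Qed.

Lemma red_divides_p x : divides p%:R x -> red x = 0.
Proof. by move=> [y ->]; rewrite rmorphM red_p mul0r. Qed.

Lemma red_unit x : red x != 0 -> exists y, x * y = 1.
Proof.
case: (int_local x) => [[N /red_divides_p]|//].
by rewrite rmorphXn => /eqP; rewrite expf_eq0 => /andP[_ ->].
Qed.

(** One exponent serves the whole maximal ideal because there are finitely many classes modulo
    [p]. *)
Lemma red_nilpotent : exists N, forall x, red x = 0 -> divides p%:R (x ^+ N).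
Proof.
have [T [r rP]] := int_residues 1.
have /fin_all_exists [N NP] (t : T) : exists N, red (r t) = 0 -> divides p%:R (r t ^+ N).
  case: (int_local (r t)) => [[N dN]|[y ry]]; first by exists N.+1.
  exists 0%N => r0; have /eqP := oner_neq0 k; case.
  by rewrite -(rmorph1 red) -ry rmorphM r0 mul0r.
exists (\max_t N t) => x x0; have [t] := rP x; rewrite expr1 => xt.
have rt0 : red (r t) = 0.
  by have := red_divides_p xt; rewrite rmorphB x0 sub0r => /eqP; rewrite oppr_eq0 => /eqP.
rewrite -[x ^+ _](subrK (r t ^+ (\max_t N t))); apply: dividesD.
  by rewrite subrXX; apply: dividesMr.
by apply: divides_trans (NP t rt0) _; apply: dividesX; apply: (leq_bigmax t).
Qed.

Lemma residue_pchar : p \in [pchar k].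
Proof. by rewrite inE p_pr -(rmorph_nat red) red_p eqxx. Qed.

(** Lifts of the iterates [a^(p^n)] of Frobenius repeat modulo [p], so the iterates repeat;
    Frobenius is injective, so the repetition goes back to [a] itself. *)
Lemma residue_perfect (a : k) : exists b, b ^+ p = a.
Proof.
have /choice [x xP] n : exists x, red x = a ^+ (p ^ n) by apply: red_surj.
have [i [d]] := int_pigeonhole 1 x; rewrite expr1 => /red_divides_p /eqP.
rewrite rmorphB !xP subr_eq0 => /eqP e; exists (a ^+ (p ^ d)).
rewrite -exprM -expnSr; elim: i e => [|i IHi]; first by rewrite expn0 expr1.
rewrite addSn (expnSr p (i + _)) (expnSr p i) (exprM a (p ^ (i + _))) (exprM a (p ^ i))
  => /eqP; rewrite -subr_eq0.
rewrite -!(pFrobenius_autE residue_pchar) -rmorphB fmorph_eq0 subr_eq0 => /eqP.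
exact: IHi.
Qed.

End IntegerRing.

(** * [Z_p]-modules from group laws on [O_K] *)

Section PadicModule.
Variables (p : nat) (p_pr : prime p) (K : fieldExtType (padic_num p_pr)).
Local Notation Zp := (padic_int p_pr).
Local Notation O := (int_ring K).
Variables (k : fieldType) (red : {rmorphism O -> k}).
Hypothesis red_surj : forall a : k, exists x, red x = a.

Variables (V : zmodType) (z : V -> O) (zinv : O -> V).
Hypotheses (zK : cancel z zinv) (zinvK : cancel zinv z) (z0 : z 0 = 0).
Hypothesis z_add : forall t x y, divides t (z x) -> divides t (z y) ->
  divides (t ^+ 2) (z (x + y) - (z x + z y)).
Hypothesis z_red : forall x y, red (z (x + y)) = red (z x) + red (z y).
Hypothesis z_cong : forall n x x' y, divides (p%:R ^+ n) (z x - z x') ->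
  divides (p%:R ^+ n) (z (x + y) - z (x' + y)).
Implicit Types (x y : V) (n : nat).

Definition ball n x := divides (p%:R ^+ n) (z x).

(** Translations of [V] preserve congruences of [z], so closeness in [O_K] can be read off the
    difference in [V]. *)
Lemma ball_sub n x y : divides (p%:R ^+ n) (z x - z y) <-> ball n (x - y).
Proof.
split=> [/(@z_cong n x y (- y))|]; first by rewrite subrr z0 subr0.
by have := @z_cong n (x - y) 0 y; rewrite z0 subr0 subrK add0r.
Qed.

Lemma ball0 n : ball n 0. Proof. by rewrite /ball z0; apply: divides0. Qed.

Lemma ballD n x y : ball n x -> ball n y -> ball n (x + y).
Proof.
move=> bx yn; rewrite /ball -[z _](subrK (z y)); apply: dividesD => //.
by have := @z_cong n x 0 y; rewrite z0 subr0 add0r; apply.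
Qed.

Lemma ballN n x : ball n x -> ball n (- x).
Proof.
move=> nx; rewrite -[- x]add0r; apply/ball_sub.
by rewrite z0 sub0r; apply: dividesN.
Qed.

Lemma ballMn n x m : ball n x -> ball n (x *+ m).
Proof. by move=> nx; elim: m => [|m IHm]; [apply: ball0|rewrite mulrS; apply: ballD]. Qed.

Lemma ball_leq m n x : (m <= n)%N -> ball n x -> ball m x.
Proof. by move=> le_mn; apply: divides_trans; apply: dividesX. Qed.

Lemma ball_sum n (I : finType) (f : I -> V) :
  (forall i, ball n (f i)) -> ball n (\sum_i f i).
Proof. by move=> fn; apply: big_ind => //; [apply: ball0|apply: ballD]. Qed.

Lemma ball_sym n x y : ball n (x - y) -> ball n (y - x).
Proof. by move=> /ballN; rewrite opprB. Qed.

Lemma ball_trans n x y w : ball n (x - y) -> ball n (y - w) -> ball n (x - w).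
Proof. by move=> xy yw; rewrite -[x](subrK y) -addrA; apply: ballD. Qed.

Lemma ball_separated x y : (forall n, ball n (x - y)) -> x = y.
Proof.
move=> bxy; apply: (can_inj zK); apply: int_eq_separated => n.
exact/ball_sub.
Qed.

Lemma ball_complete (u : nat -> V) : (forall n, ball n (u n.+1 - u n)) ->
  exists l, forall n, ball n (l - u n).
Proof.
move=> cu; have [|l lu] := @int_complete _ _ K (z \o u).
  by move=> n; apply/ball_sub.
by exists (zinv l) => n; apply/ball_sub; rewrite zinvK; apply: lu.
Qed.

Lemma z_mulrn t x m : divides t (z x) -> divides (t ^+ 2) (z (x *+ m) - m%:R * z x).
Proof.
move=> tx; elim: m => [|m IHm]; first by rewrite z0 mul0r subrr; apply: divides0.
have tm : divides t (z (x *+ m)).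
  rewrite -[z _](subrK (m%:R * z x)); apply: dividesD; last exact: dividesMl.
  by apply: divides_trans IHm; rewrite expr2; apply/dividesMr/dividesd.
rewrite mulrS; set s := z (_ + _).
have -> : s - m.+1%:R * z x = s - (z x + z (x *+ m)) + (z (x *+ m) - m%:R * z x).
  by rewrite [m.+1%:R]mulrS; ring.
by apply: dividesD => //; apply: z_add.
Qed.

(** The error term lies in [p^(2n) O_K], and [2n >= n + 1] exactly when [n > 0]. *)
Lemma ball_mulp n x : (0 < n)%N -> ball n x -> ball n.+1 (x *+ p).
Proof.
move=> n0 nx; rewrite /ball -[z _](subrK (p%:R * z x)); apply: dividesD.
  apply: divides_trans (z_mulrn p nx); rewrite -exprM; apply: dividesX.
  by rewrite muln2 -addnn -addn1 leq_add2l.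
by rewrite exprS; apply: dividesM => //; apply: dividesd.
Qed.

Lemma ball_mulp_iter n x j : (0 < n)%N -> ball n x -> ball (n + j) (x *+ p ^ j).
Proof.
move=> n0 nx; elim: j => [|j IHj]; first by rewrite addn0.
by rewrite addnS expnSr mulrnA; apply: ball_mulp; rewrite // addn_gt0 n0.
Qed.

Lemma red_z_mulrn x m : red (z (x *+ m)) = m%:R * red (z x).
Proof.
elim: m => [|m IHm]; first by rewrite z0 rmorph0 mul0r.
by rewrite mulrS z_red IHm [m.+1%:R]mulrS; ring.
Qed.

(* [p] kills [V] modulo the maximal ideal, and for [w = z y] in the maximal ideal
   [p ^+ j] maps [y] into the ideal generated by [p w] and [w ^+ j.+1]. *)
Lemma ball_contract : exists s, forall n x, ball n (x *+ p ^ (s + n)).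
Proof.
have [N NP] := red_nilpotent red_surj.
have pow y j : exists a b,
    z (y *+ p ^ j) = p%:R * z y * a + z y ^+ j.+1 * b.
  elim: j => [|j [a [b IHj]]]; first by exists 0, 1; rewrite expr1 mulr0 add0r mulr1.
  have [h] := z_mulrn p (dividesd (z (y *+ p ^ j))).
  move=> /(canRL (subrK _)); rewrite -mulrnA -expnSr => ->; rewrite IHj.
  set w := z y; pose v := p%:R * w * a + w ^+ j.+1 * b.
  (* In [p v + v^2 h] every term contains [p w] except [(w^(j+1) b)^2 h], which is divisible by
     [w^(j+2)]. *)
  exists (p%:R * a + w ^+ j * b + a * h * (v + w ^+ j.+1 * b)), (w ^+ j * b ^+ 2 * h).
  by rewrite /v !exprS; ring.
(* One factor [p] leads into the maximal ideal, [p^N] from there into the ball of index 1, and the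
   remaining [p^n] down to index [n + 1]. *)
exists N.+1 => n x.
have b1 : ball 1 (x *+ p *+ p ^ N).
  have r0 : red (z (x *+ p)) = 0 by rewrite red_z_mulrn -(rmorph_nat red) (red_p
    red_surj) mul0r.
  rewrite /ball; have [a [b ->]] := pow (x *+ p) N; rewrite expr1; apply: dividesD.
    by apply/dividesMr/dividesMr/dividesd.
  by apply/dividesMr; rewrite exprS; apply/dividesMl/NP.
have := @ball_mulp_iter 1 _ n isT b1; rewrite add1n => /(ball_leq (leqnSn n)).
by rewrite -!mulrnA -expnD -expnS.
Qed.


Lemma ball_mulrn_cong s n x (a b : nat) : (forall n x, ball n (x *+ p ^ (s + n))) ->
  a = b %[mod p ^ (s + n)] -> ball n (x *+ a - x *+ b).
Proof.
move=> sP; wlog le_ba : a b / (b <= a)%N.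
  move=> H e; have [le|/ltnW le] := leqP b a; first exact: H.
  by apply: ball_sym; apply: H.
move/eqP; rewrite eqn_mod_dvd // => /dvdnP [m ab].
by rewrite -mulrnBr // ab mulnC mulrnA; apply: ballMn.
Qed.

(** [act c x] is the limit of [x *+ a] for natural numbers [a] tending to [c]. Allowing every such
    [a], and not one chosen representative, reduces the module axioms to separatedness. *)
Lemma padic_action : exists (act : Zp -> V -> V) s, forall n (c : Zp) x (a : nat),
  a%:R = c (s + n)%N -> ball n (act c x - x *+ a).
Proof.
have [s sP] := ball_contract.
have act_ex (cx : Zp * V) : exists l, forall n,
  ball n (l - cx.2 *+ (cx.1 (s + n)%N : nat)).
  apply: ball_complete => n; apply: ball_mulrn_cong sP _.
  case: cx => c x /=; have /(padic_lift c)/eqP : (s + n <= s + n.+1)%N by rewrite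
    leq_add2l.
  rewrite -[X in _ == X]natr_Zp (Zpow_eq p_pr) => /eqP e.
  by rewrite -(modn_dvdm _ (dvdn_exp2l p (leqnSn (s + n)))) e modn_dvdm ?dvdn_exp2l.
have [f fP] := choice act_ex.
exists (fun c x => f (c, x)), s => n c x a ac.
apply: ball_trans (fP (c, x) n) _; apply: ball_mulrn_cong sP _ => /=.
move/eqP: ac; rewrite -[c _]natr_Zp (Zpow_eq p_pr) eq_sym natr_Zp => /eqP e.
by rewrite -(modn_dvdm _ (dvdn_exp2l p (leqnSn (s + n)))) e modn_dvdm ?dvdn_exp2l.
Qed.

Section Action.
Variables (act : Zp -> V -> V) (s : nat).
Hypothesis actP : forall n (c : Zp) x (a : nat),
  a%:R = c (s + n)%N -> ball n (act c x - x *+ a).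

Let actE n c x : ball n (act c x - x *+ (c (s + n)%N : nat)).
Proof. by apply: actP; rewrite natr_Zp. Qed.

Lemma act_mulA a b x : act a (act b x) = act (a * b) x.
Proof.
apply: ball_separated => n; apply: ball_trans (actE n _ _) _.
set m : nat := a _; apply: (@ball_trans _ _ (x *+ (b (s + n)%N : nat) *+ m)).
  by rewrite -mulrnBl; apply: ballMn.
rewrite -mulrnA; apply: ball_sym; apply: actP.
by rewrite natrM !natr_Zp mulrC.
Qed.

Lemma act_1 : left_id 1 act.
Proof. by move=> x; apply: ball_separated => n; apply: (@actP n 1 x 1%N). Qed.

Lemma act_Dr : right_distributive act +%R.
Proof.
move=> a x y; apply: ball_separated => n; apply: ball_trans (actE n _ _) _.
rewrite mulrnDl; apply: ball_sym; rewrite opprD addrACA.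
by apply: ballD; apply: actE.
Qed.

Lemma act_Dl x : {morph act^~ x : a b / a + b}.
Proof.
move=> a b; apply: ball_separated => n; apply: ball_sym.
apply: (@ball_trans _ _ (x *+ ((a (s + n)%N : nat) + b (s + n)%N))).
  by rewrite mulrnDr opprD addrACA; apply: ballD; apply: actE.
by apply: ball_sym; apply: actP; rewrite natrD !natr_Zp.
Qed.

(** A copy of [V] whose type mentions [act], so that the module structure of this particular action
    can be attached to it. *)
Definition act_module of left_id 1 act := GRing.Zmodule.sort V.
HB.instance Definition _ (a1 : left_id 1 act) :=
  GRing.Zmodule.on (act_module a1).
HB.instance Definition _ (a1 : left_id 1 act) :=
  GRing.Zmodule_isLmodule.Build Zp (act_module a1) act_mulA act_1 act_Dr act_Dl.

Local Notation G := (act_module act_1).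

Variables (T : finType) (r : T -> O).
Hypothesis rP : forall x : O, exists t, divides p%:R (x - r t).

(** The square of [p] is chosen so that multiplication by [p^n] is linear to the next order: at step
    [n] the error lies in [p^(2n+4)] and must lie in [p^(n+4)]. With a single [p] the case [n = 0]
    would fail. *)
Definition gen t : G := zinv (p%:R ^+ 2 * r t).

Lemma gen_approx n (x : V) : ball (n + 2) x ->
  exists t, ball (n + 3) (x - (gen t : V) *+ p ^ n).
Proof.
move=> [u xu]; have [t [v uv]] := rP u; exists t; apply/ball_sub.
have zg : z (gen t) = p%:R ^+ 2 * r t by rewrite zinvK.
have : divides (p%:R ^+ (n + 3)) (z ((gen t : V) *+ p ^ n) - p%:R ^+ n * z (gen t)).
  elim: n {xu} => [|n IHn]; first by rewrite mul1r subrr; apply: divides0.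
  have gn : ball (n + 2) ((gen t : V) *+ p ^ n).
    rewrite addnC; apply: ball_mulp_iter => //.
    by rewrite /ball zg; apply/dividesMr/dividesd.
  rewrite expnSr mulrnA -[z _](subrK (p%:R * z ((gen t : V) *+ p ^ n))) -addrA.
  apply: dividesD.
    apply: divides_trans (z_mulrn p gn); rewrite -exprM; apply: dividesX.
    by lia.
  by rewrite exprS -mulrA -mulrBr addSn exprS; apply: dividesM => //; apply: dividesd.
move=> /dividesN; rewrite opprB zg => d.
rewrite -[z x](subrK (p%:R ^+ n * (p%:R ^+ 2 * r t))) -addrA; apply: dividesD => //.
rewrite xu mulrA -exprD -mulrBr uv mulrA -exprSr addnS.
exact/dividesMr/dividesd.
Qed.

(** Step [j] of the approximation subtracts [p^(n+j)] times one generator. The common factor [p^n]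
    is kept outside the combination, because it shows that the ball lies in [p^n G], as the
    comparison of topologies requires. *)
Lemma ball_comb n (x : V) : ball (n + 2) x ->
  exists c : T -> Zp, x = ((\sum_t c t *: gen t : G) : V) *+ p ^ n.
Proof.
move=> nx.
have /choice [t tP] (jx : nat * V) : exists t, ball (jx.1 + 2) jx.2 ->
    ball (jx.1 + 3) (jx.2 - (gen t : V) *+ p ^ jx.1).
  have [/gen_approx[t tP]|nb] := pselect (ball (jx.1 + 2) jx.2); first by exists t.
  by have [t _] := rP 0; exists t.
pose rest := fix rest j : V := if j is j'.+1 then
  rest j' - (gen (t ((n + j')%N, rest j')) : V) *+ p ^ (n + j') else x.
have restP j : ball (n + j + 2) (rest j).
  elim: j => [|j IHj]; first by rewrite addn0.
  by rewrite (_ : n + j.+1 + 2 = n + j + 3)%N; [apply: (tP (_, _) IHj)|lia].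
pose ti j := t ((n + j)%N, rest j).
(* The coefficient of a generator collects the powers of [p] from the steps at which it was
   selected. *)
pose C i j : Zp := \sum_(l < j) (if ti l == i then p%:R ^+ l else 0).
have /fin_all_exists [c cP] i : exists c, forall j, divides (p%:R ^+ j) (c - C i j).
  apply: padic_complete => j; rewrite /C big_ord_recr /= addrAC subrr add0r.
  by case: ifP => _; [apply: dividesd|apply: divides0].
have xE j : x = rest j + ((\sum_i C i j *: gen i : G) : V) *+ p ^ n.
  elim: j => [|j IHj].
    rewrite big1 ?mul0rn ?addr0 // => i _; rewrite /C big_ord0; exact: scale0r.
  rewrite {1}IHj /=.
  have -> : (\sum_i C i j.+1 *: gen i : G) = (\sum_i C i j *: gen i : G) + gen (ti j)
    *+ p ^ j.
    rewrite (bigD1 (ti j)) // [in RHS](bigD1 (ti j)) //= addrAC; congr (_ + _).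
      rewrite /C big_ord_recr /= eqxx scalerDl; congr (_ + _).
      by rewrite -natrX scaler_nat.
    apply: eq_bigr => i ni; rewrite /C big_ord_recr /= eq_sym (negPf ni) addr0 //.
  move: (\sum_i C i j *: gen i) => A.
  rewrite [X in _ = _ + X](mulrnDl (p ^ n) (A : V)) -mulrnA -expnD (addnC j) -/(ti j).
  by rewrite (addrC (A *+ p ^ n)) addrA subrK.
have [s' s'P] := ball_contract.
exists c; apply: ball_separated => m; rewrite {1}(xE (s' + m)%N) -addrA.
apply: ballD; first by apply: ball_leq (restP _); lia.
rewrite -mulrnBl; apply: ballMn.
rewrite -[X in ball m X](sumrB (V := G)); apply: ball_sum => i.
rewrite -[X in ball m X](scalerBl (V := G)) -opprB; have [d ->] := cP i (s' + m)%N.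
rewrite scaleNr; apply: ballN; rewrite -scalerA -natrX scaler_nat.
exact: s'P.
Qed.

Lemma act_fin_gen : fin_gen (G : lmodType Zp).
Proof.
(* Representatives modulo [p^2] move any point into the ball of index 2, which the elements [gen t]
   span. *)
have [T2 [r2 r2P]] := int_residues K 2.
pose g (i : T + T2) : G := match i with inl t => gen t | inr t => zinv (r2 t) end.
exists #|{: T + T2}|, (g \o enum_val) => x.
have [t xt] := r2P (z x).
have /(@ball_comb 0) [c xc] : ball 2 (x - (zinv (r2 t) : V)) by apply/ball_sub;
  rewrite zinvK.
pose c' (i : T + T2) := match i with inl u => c u | inr u => (u == t)%:R end.
exists (c' \o enum_val); rewrite -(big_enum_val (fun i => c' i *: g i)) /=.
rewrite big_sumType /= [X in _ + X](bigD1 t) //= eqxx scale1r.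
rewrite [X in _ + (_ + X)]big1 ?addr0; last by move=> u /negPf ->; rewrite scale0r.
by rewrite -[LHS](subrK (zinv (r2 t) : V)) xc.
Qed.

(** The two systems of neighborhoods are cofinal: the ball of index [i + 2] lies in [p^i G] by
    [ball_comb], and [p^(s'+n) G] lies in the ball of index [n] by [ball_contract]. *)
Lemma act_open (A : set (padic_module (G : lmodType Zp))) : open A <->
  forall x : V, A x -> exists n, forall y : V, divides (p%:R ^+ n) (z y - z x) -> A y.
Proof.
rewrite openE; split=> [oA x /oA [i _ iA]|oA x /oA [n nA]].
  exists (i + 2)%N => y /ball_sub/ball_comb [c yx]; apply: iA.
  exists (\sum_t c t *: gen t) => //.
  by rewrite -[RHS](subrK (x : V)) yx addrC.
have [s' s'P] := ball_contract; exists (s' + n)%N => // _ [w _ <-].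
apply: nA; apply/ball_sub; rewrite [_ - _](_ : _ = (w : V) *+ p ^ (s' + n));
  first exact: s'P.
have addKr (a b : V) : a + b - a = b by rewrite addrAC subrr add0r.
exact: addKr.
Qed.

Lemma act_moduleP : exists (H : lmodType Zp) (h : H -> O),
    [/\ bijective h, forall x y : H, exists x' y' : V,
        [/\ h x = z x', h y = z y' & h (x + y) = z (x' + y')], fin_gen H &
      forall A : set (padic_module H), open A <->
        forall x : H, A x -> exists n, forall y : H,
          divides (p%:R ^+ n) (h y - h x) -> A y].
Proof.
exists (act_module act_1 : lmodType Zp), z; split; first by exists zinv.
- by move=> x y; exists x, y.
- exact: act_fin_gen.
- exact: act_open.
Qed.

End Action.
End PadicModule.

Section LawGroup.
Variables (T : choiceType) (zero : T) (add : T -> T -> T) (opp : T -> T).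
Hypotheses (addA : associative add) (addC : commutative add).
Hypotheses (add0 : left_id zero add) (addN : left_inverse zero opp add).

Definition law_group of associative add := Choice.sort T.
HB.instance Definition _ (a : associative add) := Choice.on (law_group a).
HB.instance Definition _ (a : associative add) :=
  GRing.isZmodule.Build (law_group a) addA addC add0 addN.

Lemma law_groupP : exists V : zmodType, exists2 h : V -> T, bijective h &
  h 0 = zero /\ forall x y, h (x + y) = add (h x) (h y).
Proof.
exists (law_group addA), (fun x => x); last by [].
by exists (fun x => x).
Qed.

End LawGroup.

(* The estimates make the balls around [0] subgroups, on which multiplication by [p]
   behaves as in the additive group. *)
Theorem padic_module_of_group_law (p : nat) (p_pr : prime p)
    (K : fieldExtType (padic_num p_pr)) (k : fieldType)
    (red : {rmorphism int_ring K -> k})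
    (red_surj : forall a : k, exists x, red x = a)
    (add : int_ring K -> int_ring K -> int_ring K) (opp : int_ring K -> int_ring K)
    (addA : associative add) (addC : commutative add) (add0 : left_id 0 add)
    (addN : left_inverse 0 opp add)
    (add_sq : forall t x y, divides t x -> divides t y ->
      divides (t ^+ 2) (add x y - (x + y)))
    (add_red : forall x y, red (add x y) = red x + red y)
    (add_cong : forall n x x' y, divides (p%:R ^+ n) (x - x') ->
      divides (p%:R ^+ n) (add x y - add x' y)) :
  exists (G : lmodType (padic_int p_pr)) (h : G -> int_ring K),
    [/\ bijective h, forall x y, h (x + y) = add (h x) (h y), fin_gen G &
      forall A : set (padic_module G), open A <->
        forall x : G, A x -> exists n, forall y : G,
          divides (p%:R ^+ n) (h y - h x) -> A y].
Proof.
have [V [z [zinv zK zinvK] [z0 zD]]] := law_groupP addA addC add0 addN.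
have z_add t x y : divides t (z x) -> divides t (z y) ->
  divides (t ^+ 2) (z (x + y) - (z x + z y)) by rewrite zD; apply: add_sq.
have z_red x y : red (z (x + y)) = red (z x) + red (z y) by rewrite zD.
have z_cong n x x' y : divides (p%:R ^+ n) (z x - z x') ->
  divides (p%:R ^+ n) (z (x + y) - z (x' + y)) by rewrite !zD; apply: add_cong.
have [act [s actP]] := padic_action red_surj zinvK z0 z_add z_red z_cong.
have [T [r rP]] := int_residues K 1.
have [G [h [h_bij hD h_fin h_open]]] :=
  act_moduleP red_surj zK zinvK z0 z_add z_red z_cong actP rP.
exists G, h; split=> // x y.
by have [x' [y' [-> -> ->]]] := hD x y; rewrite zD.
Qed.

(** * The chord-tangent law over a field *)

Section ChordTangent.
Variables (F : fieldType) (W : weierstrass F).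
Local Notation a1 := (wa1 W).
Local Notation a2 := (wa2 W).
Local Notation a3 := (wa3 W).
Local Notation a4 := (wa4 W).
Local Notation a6 := (wa6 W).
Implicit Types P Q R : option (F * F).

Definition affine_neg P : option (F * F) :=
  if P is Some (x, y) then Some (x, - y - a1 * x - a3) else None.

Definition affine_on P : Prop := if P is Some (x, y) then
  y ^+ 2 + a1 * x * y + a3 * y = x ^+ 3 + a2 * x ^+ 2 + a4 * x + a6 else True.

Definition affine_nonsingular P : Prop := if P is Some (x, y) then
  ~ (2 * y + a1 * x + a3 = 0 /\ 3 * x ^+ 2 + 2 * a2 * x + a4 - a1 * y = 0) else True.

Definition good P := affine_on P /\ affine_nonsingular P.

(* [P + Q + R = 0]: the curve cuts out the divisor [P + Q + R] on a line, which is
   [y = l x + n] when no point is the origin. *)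
Definition collinear P Q R : Prop :=
  match P, Q, R with
  | Some (x1, y1), Some (x2, y2), Some (x3, y3) => exists l n,
    [/\ y1 = l * x1 + n, y2 = l * x2 + n, y3 = l * x3 + n &
     [/\ x1 + x2 + x3 = l ^+ 2 + a1 * l - a2,
         x1 * x2 + x1 * x3 + x2 * x3 = a4 - a1 * n - 2 * l * n - a3 * l &
         x1 * x2 * x3 = n ^+ 2 + a3 * n - a6]]
  | None, _, _ => R = affine_neg Q
  | _, None, _ => R = affine_neg P
  | _, _, None => Q = affine_neg P
  end.

Lemma affine_negK : involutive affine_neg.
Proof. by case=> [[x y]|] //=; congr (Some (_, _)); ring. Qed.

Lemma collinear_sym12 P Q R : collinear P Q R -> collinear Q P R.
Proof.
case: P Q R => [[x1 y1]|] [[x2 y2]|] [[x3 y3]|] //=.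
- by move=> [l [n [? ? ? [e1 e2 e3]]]]; exists l, n; split=> //; split;
    rewrite -?e1 -?e2 -?e3; ring.
- by case=> -> ->; congr (Some (_, _)); ring.
Qed.

Lemma collinear_sym23 P Q R : collinear P Q R -> collinear P R Q.
Proof.
case: P Q R => [[x1 y1]|] [[x2 y2]|] [[x3 y3]|] //=.
- by move=> [l [n [? ? ? [e1 e2 e3]]]]; exists l, n; split=> //; split;
    rewrite -?e1 -?e2 -?e3; ring.
- by case=> -> ->; congr (Some (_, _)); ring.
Qed.

Lemma collinear_neg P Q R :
  collinear P Q R -> collinear (affine_neg P) (affine_neg Q) (affine_neg R).
Proof.
case: P Q R => [[x1 y1]|] [[x2 y2]|] [[x3 y3]|] //=.
- move=> [l [n [-> -> -> [e1 e2 e3]]]]; exists (- l - a1), (- n - a3).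
  by split; [| | |split]; rewrite ?e1 ?e2 ?e3; ring.
- by case=> -> ->; congr (Some (_, _)); ring.
- by case=> -> ->; congr (Some (_, _)); ring.
- by case=> -> ->; congr (Some (_, _)); ring.
Qed.

(* Two cubics in [t] with the same leading and subleading coefficients agree as soon as
   they agree at two points, counted with multiplicity. *)
Lemma collinear_affine x1 y1 x2 y2 l :
    affine_on (Some (x1, y1)) -> affine_on (Some (x2, y2)) ->
    y2 - y1 = l * (x2 - x1) ->
    (x1 = x2 -> l * (2 * y1 + a1 * x1 + a3) = 3 * x1 ^+ 2 + 2 * a2 * x1 + a4 - a1 * y1) ->
  let x3 := l ^+ 2 + a1 * l - a2 - x1 - x2 in
  collinear (Some (x1, y1)) (Some (x2, y2)) (Some (x3, y1 + l * (x3 - x1))).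
Proof.
move=> /= P_on Q_on y12 tan; exists l, (y1 - l * x1); set n := y1 - _.
set x3 := _ - x2; have y1E : y1 = l * x1 + n by rewrite /n; ring.
have y2E : y2 = l * x2 + n by rewrite -[y2](subrK y1) y12 y1E; ring.
pose B := a4 - a1 * n - 2 * l * n - a3 * l; pose C := n ^+ 2 + a3 * n - a6.
pose e2 := x1 * x2 + x1 * x3 + x2 * x3; pose e3 := x1 * x2 * x3.
have f1 : (B - e2) * x1 = C - e3.
  apply/eqP; rewrite -subr_eq0; apply/eqP; move/eqP: P_on; rewrite -subr_eq0 => /eqP P_on.
  rewrite -[RHS]oppr0 -[in RHS]P_on y1E /B /C /e2 /e3 /x3; ring.
have f2 : (B - e2) * x2 = C - e3.
  apply/eqP; rewrite -subr_eq0; apply/eqP; move/eqP: Q_on; rewrite -subr_eq0 => /eqP Q_on.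
  rewrite -[RHS]oppr0 -[in RHS]Q_on y2E /B /C /e2 /e3 /x3; ring.
have Be : B = e2.
  have [x12|x12] := eqVneq x1 x2; last first.
    apply/eqP; rewrite -subr_eq0; apply: contraT => Be; case/eqP: x12.
    by apply: (mulfI Be); rewrite f1 f2.
  apply/eqP; rewrite -subr_eq0; apply/eqP; move/eqP: (tan x12);
    rewrite -subr_eq0 => /eqP tan'.
  rewrite -[RHS]oppr0 -[in RHS]tan' y1E /B /e2 /x3 -x12; ring.
have Ce : C = e3 by move: f1; rewrite Be subrr mul0r => /eqP;
  rewrite eq_sym subr_eq0 => /eqP.
split; rewrite ?y1E ?y2E //; first by ring.
by split; rewrite -/B -/C ?Be ?Ce // /x3; ring.
Qed.

Lemma affine_same_x x y1 y2 :
    affine_on (Some (x, y1)) -> affine_on (Some (x, y2)) ->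
  y1 + y2 + a1 * x + a3 != 0 -> y1 = y2.
Proof.
move=> /= e1 e2 nz; apply/eqP; rewrite -subr_eq0.
have /eqP : (y1 - y2) * (y1 + y2 + a1 * x + a3) = 0.
  rewrite -[RHS](subrr (x ^+ 3 + a2 * x ^+ 2 + a4 * x + a6)) -{1}e1 -e2; ring.
by rewrite mulf_eq0 (negPf nz) orbF.
Qed.

Lemma collinear_add P Q : good P -> good Q ->
  collinear P Q (affine_neg (affine_add W P Q)).
Proof.
case: P Q => [[x1 y1]|] [[x2 y2]|] // [P_on P_ns] [Q_on Q_ns].
rewrite /affine_add; case: ifP => [/andP[/eqP x12 /eqP y12]|/negbT nopp].
  rewrite /= x12; congr (Some (_, _)); apply/eqP; rewrite -subr_eq0 -y12; apply/eqP; ring.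
set l := if _ then _ else _; set x3 := _ - x2.
rewrite [affine_neg _](_ : _ = Some (x3, y1 + l * (x3 - x1))); last first.
  by rewrite /=; congr (Some (_, _)); ring.
apply: collinear_affine => //; rewrite /l; have [x12|x12] := eqVneq x1 x2.
- move: nopp; rewrite x12 eqxx /= => nz; rewrite subrr mulr0.
  by rewrite (affine_same_x (x := x2) (y1 := y1) (y2 := y2)) ?subrr // -?x12.
- by rewrite mulfVK // subr_eq0 eq_sym.
- move=> _; rewrite mulfVK //; move: nopp; rewrite x12 eqxx /= => nz.
  have y12 : y1 = y2 by apply: (affine_same_x (x := x2)); rewrite -?x12 // x12.
  by apply: contraNneq nz => <-; rewrite y12; apply/eqP; ring.
- by move=> e; rewrite e eqxx in x12.
Qed.

(** The coefficient equations give [a2] and [a4] and force the slope. If [Q = - P] with [R] finite,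
    the line is not vertical, so [P = Q] and the tangent equation makes both partial derivatives
    vanish at [P], against nonsingularity. *)
Lemma collinear_unique P Q R : good P -> good Q -> collinear P Q R ->
  R = affine_neg (affine_add W P Q).
Proof.
case: P Q R => [[x1 y1]|] [[x2 y2]|] [[x3 y3]|] // [P_on P_ns] [Q_on Q_ns] /=; last first.
  case=> -> ->; rewrite eqxx /= (_ : _ + _ = 0) ?eqxx //; ring.
move=> [l [n [y1E y2E y3E [e1 e2 e3]]]].
have a2E : a2 = l ^+ 2 + a1 * l - (x1 + x2 + x3) by rewrite e1; ring.
have a4E : a4 = x1 * x2 + x1 * x3 + x2 * x3 + a1 * n + 2 * l * n + a3 * l by rewrite
  e2; ring.
have tan : x1 = x2 -> l * (2 * y1 + a1 * x1 + a3) = 3 * x1 ^+ 2 + 2 * a2 * x1 + a4 - a1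
  * y1.
  by move=> x12; rewrite a2E a4E y1E -x12; ring.
case: ifP => [/andP[/eqP x12 /eqP y12]|/negbT nopp].
  have D0 : 2 * y1 + a1 * x1 + a3 = 0 by rewrite -y12 y2E x12 y1E x12; ring.
  by case: P_ns; split=> //; rewrite -tan // D0 mulr0.
set s := if x1 == x2 then _ else _; have -> : s = l.
  rewrite /s; case: eqVneq => [x12|x12]; last first.
    rewrite y1E y2E (_ : _ - _ = l * (x2 - x1)); last by ring.
    by rewrite mulfK // subr_eq0 eq_sym.
  rewrite -tan // mulfK //; move: nopp; rewrite x12 eqxx /=; apply: contraNneq => <-.
  by rewrite y1E y2E x12; apply/eqP; ring.
have x3E : l ^+ 2 + a1 * l - a2 - x1 - x2 = x3 by rewrite a2E; ring.
by rewrite x3E y3E y1E; congr (Some (_, _)); ring.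
Qed.

Lemma affine_addC P Q : good P -> good Q -> affine_add W P Q = affine_add W Q P.
Proof.
move=> gP gQ; apply: (can_inj affine_negK).
by apply: collinear_unique => //; apply/collinear_sym12/collinear_add.
Qed.

Lemma affine_addN P : affine_add W (affine_neg P) P = None.
Proof. by case: P => [[x y]|] //=; rewrite eqxx (_ : _ + a3 = 0) ?eqxx //; ring. Qed.

(* Put [Q] at the origin with the line [P Q] as the x-axis, and let [m] be the slope of
   the line [Q R], with remaining intersection points of abscissas [e] and [g]. The line
   through [P + Q] and [R] then has slope [(m^2 + e - g) / m] and the line through [P] and
   [Q + R] has slope [(e - g) / m], whether or not these points are distinct. *)
Lemma collinear_assoc x1 y1 x2 y2 x3 y3 xS yS xU yU l l' n n' :
    [/\ y1 = l * x1 + n, y2 = l * x2 + n, yS = l * xS + n &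
     [/\ x1 + x2 + xS = l ^+ 2 + a1 * l - a2,
         x1 * x2 + x1 * xS + x2 * xS = a4 - a1 * n - 2 * l * n - a3 * l &
         x1 * x2 * xS = n ^+ 2 + a3 * n - a6]] ->
    [/\ y2 = l' * x2 + n', y3 = l' * x3 + n', yU = l' * xU + n' &
     [/\ x2 + x3 + xU = l' ^+ 2 + a1 * l' - a2,
         x2 * x3 + x2 * xU + x3 * xU = a4 - a1 * n' - 2 * l' * n' - a3 * l' &
         x2 * x3 * xU = n' ^+ 2 + a3 * n' - a6]] ->
    l != l' ->
  exists X, collinear (affine_neg (Some (xS, yS))) (Some (x3, y3)) X /\
            collinear (Some (x1, y1)) (affine_neg (Some (xU, yU))) X.
Proof.
move=> [y1E y2E ySE [e1 e2 e3]] [y2E' y3E yUE [f1 f2 f3]] ne_l.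
pose m := l' - l; have m0 : m != 0 by rewrite subr_eq0 eq_sym.
have l'E : l' = l + m by rewrite /m; ring.
(* The two lines determine all coefficients of the curve and all ordinates but [y2]; once these are
   eliminated, what remains are identities of rational functions. *)
have nE : n = y2 - l * x2 by rewrite y2E; ring.
have n'E : n' = y2 - (l + m) * x2 by rewrite y2E' l'E; ring.
have a2E : a2 = l ^+ 2 + a1 * l - (x1 + x2 + xS) by rewrite e1; ring.
have a1E : a1 = (x3 + xU - x1 - xS) / m - 2 * l - m.
  have : (a1 + 2 * l + m) * m = x3 + xU - x1 - xS.
    have -> : x3 + xU - x1 - xS = x2 + x3 + xU - (x1 + x2 + xS) by ring.
    by rewrite f1 e1 l'E; ring.
  by move=> <-; field.
have a4E : a4 = x1 * x2 + x1 * xS + x2 * xS + a1 * n + 2 * l * n + a3 * l by rewrite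
  e2; ring.
have a3E : a3 = (x1 * x2 + x1 * xS + x2 * xS - (x2 * x3 + x2 * xU + x3 * xU)
    - a1 * (n' - n) - 2 * (l' * n' - l * n)) / m.
  by apply: (canRL (mulfK m0)); rewrite e2 f2 l'E; ring.
have a6E : a6 = n ^+ 2 + a3 * n - x1 * x2 * xS by rewrite e3; ring.
clear e1 e2 e3 f1 f2 f3 y2E y2E' ne_l; clearbody m.
subst yS y3 y1 yU n n' l'.
pose u := l + m + (xS - xU) / m; pose v := l + (xS - xU) / m.
pose xX := u ^+ 2 + a1 * u - a2 - xS - x3.
exists (Some (xX, (l + m) * x3 + (y2 - (l + m) * x2) + u * (xX - x3))); split.
- exists u, ((l + m) * x3 + (y2 - (l + m) * x2) - u * x3).
  by split; [| | |split]; rewrite /xX /u ?a6E ?a4E ?a3E ?a2E ?a1E; field.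
- exists v, (l * x1 + (y2 - l * x2) - v * x1).
  by split; [| | |split]; rewrite /xX /u /v ?a6E ?a4E ?a3E ?a2E ?a1E; field.
Qed.

Lemma affine_add_collinear P Q R X : good P -> good Q -> good R ->
    good (affine_add W P Q) -> good (affine_add W Q R) ->
    collinear (affine_add W P Q) R X -> collinear P (affine_add W Q R) X ->
  affine_add W (affine_add W P Q) R = affine_add W P (affine_add W Q R).
Proof.
move=> gP gQ gR gPQ gQR c1 c2; apply: (can_inj affine_negK).
by rewrite -(collinear_unique gPQ gR c1) -(collinear_unique gP gQR c2).
Qed.

Lemma affine_addA P Q R : good P -> good Q -> good R ->
    good (affine_add W P Q) -> good (affine_add W Q R) ->
  affine_add W (affine_add W P Q) R = affine_add W P (affine_add W Q R).
Proof.
move=> gP gQ gR gPQ gQR.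
case: P gP gPQ => [[x1 y1]|] gP gPQ //; case: Q gQ gPQ gQR => [[x2 y2]|] gQ gPQ gQR //.
have add0 T : affine_add W T None = T by case: T => [[]|].
case: R gR gQR => [[x3 y3]|] gR gQR; last by rewrite !add0.
pose P := Some (x1, y1); pose Q := Some (x2, y2); pose R := Some (x3, y3).
have cS := collinear_add gP gQ; have cU := collinear_add gQ gR.
set S := affine_neg _ in cS; set U := affine_neg _ in cU.
have A_S : affine_add W P Q = affine_neg S by rewrite affine_negK.
have B_U : affine_add W Q R = affine_neg U by rewrite affine_negK.
suff [X [c1 c2]] : exists X, collinear (affine_neg S) R X /\ collinear P (affine_neg U) X.
  by apply: (@affine_add_collinear P Q R X) => //; rewrite ?A_S ?B_U.
have gA : good (affine_neg S) by rewrite -A_S.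
case ES : S cS => [[xS yS]|] cS; last first.
  exists (affine_neg R); split=> //; apply/collinear_sym23.
  have := collinear_neg cU; rewrite [affine_neg (Some (x2, y2))](_ : _ = P) //.
  by rewrite -[RHS]affine_negK -[affine_neg P]cS.
case EU : U cU => [[xU yU]|] cU.
  move: (cS) (cU) => [l [n [y1E y2E ySE eqs]]] [l' [n' [y2E' y3E yUE eqs']]].
  (* If both lines coincide they cut out the same divisor, so the pairs [P, S] and [R, U] agree up
     to order. The case [R = P] is settled by commutativity; if [P = U] and [S = R], both sums are
     the origin. *)
  have [ll'|ne_l] := eqVneq l l';
    last by apply: (@collinear_assoc x1 y1 x2 y2 x3 y3 xS yS xU yU l l' n n').
  have nn' : n = n' by apply: (addrI (l * x2)); rewrite -y2E y2E' ll'.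
  case: eqs eqs' => [e1 e2 _] [f1 f2 _]; rewrite -ll' -nn' -e1 -e2 in f1 f2.
  have sumE : x3 + xU = x1 + xS.
    by apply: (addrI x2); rewrite addrA f1; ring.
  have prodE : x3 * xU = x1 * xS.
    by apply: (addrI (x2 * (x3 + xU))); rewrite mulrDr f2 -mulrDr sumE; ring.
  have /eqP : (x1 - x3) * (x1 - xU) = 0.
    rewrite (_ : _ * _ = x1 ^+ 2 - x1 * (x3 + xU) + x3 * xU); last by ring.
    by rewrite sumE prodE; ring.
  rewrite mulf_eq0 !subr_eq0 => /orP[/eqP x13|/eqP x1U].
    have PR : P = R by rewrite /P /R x13 y1E y3E -ll' -nn' x13.
    exists (affine_neg (affine_add W P (affine_neg S))); rewrite -PR.
    rewrite -ES -EU; split; first by apply/collinear_sym12/collinear_add.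
    have -> : affine_neg U = affine_neg S; last exact: collinear_add.
    by rewrite -A_S -B_U PR affine_addC.
  have PU : P = Some (xU, yU) by rewrite /P x1U y1E yUE -ll' -nn' x1U.
  have SR : Some (xS, yS) = R.
    have x3S : x3 = xS by apply: (addIr xU); rewrite sumE x1U addrC.
    by rewrite /R x3S ySE y3E -ll' -nn' x3S.
  exists None; rewrite SR -PU; split=> //.
  by apply: collinear_sym12.
exists (affine_neg P); split=> //.
have := collinear_neg cS; rewrite -/P -[affine_neg (Some (x2, y2))]affine_negK.
move=> /collinear_sym12/collinear_sym23.
by rewrite affine_negK -[affine_neg (Some (x2, y2))]cU => /collinear_sym12.
Qed.

End ChordTangent.

(** * The chart at the origin *)

Section Chart.
Variables (O : comNzRingType) (k : fieldType) (red : {rmorphism O -> k}).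
Hypothesis red_unit : forall x, red x != 0 -> exists y, x * y = 1.
Hypothesis surj : forall g : O -> O,
  (forall x y, exists u v, u * v = 1 /\ g x - g y = (x - y) * u) ->
  forall t, exists x, g x = t.
Variable W : weierstrass O.
Local Notation a1 := (wa1 W).
Local Notation a2 := (wa2 W).
Local Notation a3 := (wa3 W).
Local Notation a4 := (wa4 W).
Local Notation a6 := (wa6 W).
Hypotheses (r1 : red a1 = 0) (r2 : red a2 = 0) (r3 : red a3 = 0).
Hypotheses (r4 : red a4 = 0) (r6 : red a6 = 0).
Implicit Types x y z w t : O.

Definition unit_inv x : O :=
  if pselect (exists y, x * y = 1) is left ex then projT1 (cid ex) else 0.

Lemma unit_invP x : red x != 0 -> x * unit_inv x = 1.
Proof.
move=> /red_unit ux; rewrite /unit_inv; case: pselect => // ex.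
exact: projT2 (cid ex).
Qed.

Lemma unit_mulI x y z : red x != 0 -> x * y = x * z -> y = z.
Proof.
move=> ux e; have := congr1 ( *%R (unit_inv x)) e.
by rewrite !mulrA ![unit_inv x * _]mulrC unit_invP // !mul1r.
Qed.

Definition red_simp := (rmorphD, rmorphM, rmorphN, rmorphXn, rmorph1, rmorph0,
  rmorph_nat, r1, r2, r3, r4, r6, mul0r, mulr0, addr0, add0r, oppr0).

(* The equation of the curve in the coordinates [z = - x / y] and [w = - 1 / y], in which
   the origin is [(0, 0)]. *)
Definition chart_eq z w : Prop :=
  w = z ^+ 3 + a1 * z * w + a2 * z ^+ 2 * w + a3 * w ^+ 2 + a4 * z * w ^+ 2 + a6 * w ^+ 3.

(** The difference of the equations at two points splits into a multiple of [w2 - w1] and a multiple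
    of [z2 - z1]; [slope_den] and [slope_num] are the cofactors. Their quotient is the slope of the
    chord, and of the tangent when the points agree. *)
Definition slope_den z w1 w2 : O := 1 - a1 * z - a2 * z ^+ 2 - a3 * (w1 + w2)
  - a4 * z * (w1 + w2) - a6 * (w1 ^+ 2 + w1 * w2 + w2 ^+ 2).

Definition slope_num z1 z2 w1 : O :=
  z1 ^+ 2 + z1 * z2 + z2 ^+ 2 + a1 * w1 + a2 * (z1 + z2) * w1 + a4 * w1 ^+ 2.

Lemma red_slope_den z w1 w2 : red (slope_den z w1 w2) = 1.
Proof. by rewrite /slope_den !red_simp. Qed.

Lemma slope_den_neq0 z w1 w2 : red (slope_den z w1 w2) != 0.
Proof. by rewrite red_slope_den oner_eq0. Qed.

Lemma slopeP z1 z2 w1 w2 : chart_eq z1 w1 -> chart_eq z2 w2 ->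
  (w2 - w1) * slope_den z2 w1 w2 = (z2 - z1) * slope_num z1 z2 w1.
Proof.
move=> e1 e2; apply/eqP; rewrite -subr_eq0; apply/eqP.
pose G z w := z ^+ 3 + a1 * z * w + a2 * z ^+ 2 * w + a3 * w ^+ 2 + a4 * z * w ^+ 2 +
  a6 * w ^+ 3.
have -> : (w2 - w1) * slope_den z2 w1 w2 - (z2 - z1) * slope_num z1 z2 w1 =
  (w2 - G z2 w2) - (w1 - G z1 w1) by rewrite /slope_den /slope_num /G; ring.
by rewrite -[G z2 w2]e2 -[G z1 w1]e1 !subrr.
Qed.

(** As a function of [w], the equation has the unit [slope_den z x y] as difference quotient, so it
    takes every value. *)
Lemma chart_ex z : exists w, chart_eq z w.
Proof.
have [|w] := @surj (fun w => w - (a1 * z * w + a2 * z ^+ 2 * w + a3 * w ^+ 2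
    + a4 * z * w ^+ 2 + a6 * w ^+ 3)) _ (z ^+ 3).
  move=> x y; exists (slope_den z x y), (unit_inv (slope_den z x y)); split.
    exact/unit_invP/slope_den_neq0.
  by rewrite /slope_den; ring.
by move=> /eqP; rewrite subr_eq => /eqP e; exists w; rewrite /chart_eq {1}e; ring.
Qed.

Definition chartw z : O := projT1 (cid (chart_ex z)).

Lemma chartwP z : chart_eq z (chartw z).
Proof. exact: projT2 (cid (chart_ex z)). Qed.

Lemma chartw_unique z w : chart_eq z w -> w = chartw z.
Proof.
move=> e; have := slopeP (chartwP z) e; rewrite subrr mul0r => e0.
apply/eqP; rewrite -subr_eq0; apply/eqP/(@unit_mulI (slope_den z (chartw z) w)).
  exact: slope_den_neq0.
by rewrite mulr0 mulrC.
Qed.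

Lemma chartw0 : chartw 0 = 0.
Proof. by apply/esym/chartw_unique; rewrite /chart_eq; ring. Qed.

Section Line.
Variables z1 z2 : O.
Let w1 := chartw z1.
Let w2 := chartw z2.

Definition lam : O := slope_num z1 z2 w1 * unit_inv (slope_den z2 w1 w2).
Definition nu : O := w1 - lam * z1.
(* The equation of the curve on the line [w = lam z + nu] is
   [cub3 z^3 + cub2 z^2 + cub1 z + cub0 = 0]. *)
Definition cub3 : O := 1 + a2 * lam + a4 * lam ^+ 2 + a6 * lam ^+ 3.
Definition cub2 : O := a1 * lam + a2 * nu + a3 * lam ^+ 2 + 2 * a4 * lam * nu
  + 3 * a6 * lam ^+ 2 * nu.
Definition cub1 : O := a1 * nu - lam + 2 * a3 * lam * nu + a4 * nu ^+ 2
  + 3 * a6 * lam * nu ^+ 2.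
Definition cub0 : O := a3 * nu ^+ 2 - nu + a6 * nu ^+ 3.
Definition third : O := - z1 - z2 - cub2 * unit_inv cub3.

Lemma lamP : lam * slope_den z2 w1 w2 = slope_num z1 z2 w1.
Proof. by rewrite -mulrA [unit_inv _ * _]mulrC unit_invP ?mulr1 ?slope_den_neq0. Qed.

Lemma lineP1 : chartw z1 = lam * z1 + nu.
Proof. by rewrite /nu addrC subrK. Qed.

Lemma lineP2 : chartw z2 = lam * z2 + nu.
Proof.
suff : w2 - w1 = lam * (z2 - z1) by rewrite -/w2 => /(canRL (subrK _)) ->; rewrite /nu;
  ring.
apply: (@unit_mulI (slope_den z2 w1 w2)); first exact: slope_den_neq0.
by rewrite mulrC (slopeP (chartwP _) (chartwP _)) -lamP -/w1 -/w2 mulrA mulrC [lam *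
  _]mulrC.
Qed.

Lemma red_cub3 : red cub3 = 1.
Proof. by rewrite /cub3 !red_simp. Qed.

Lemma cub3_neq0 : red cub3 != 0.
Proof. by rewrite red_cub3 oner_eq0. Qed.

(** First of Vieta's relations for the roots [z1], [z2], [third]; [third] is defined so that it
    holds. *)
Lemma cub2E : cub2 = - cub3 * (z1 + z2 + third).
Proof.
have -> : - cub3 * (z1 + z2 + third) = cub2 * (cub3 * unit_inv cub3).
  by rewrite /third; ring.
by rewrite unit_invP ?mulr1 // cub3_neq0.
Qed.

(* The divided difference of the cubic along the line vanishes, also when [z1 = z2]. *)
Lemma cub1E : cub1 = cub3 * (z1 * z2 + z1 * third + z2 * third).
Proof.
have dd : cub3 * (z1 ^+ 2 + z1 * z2 + z2 ^+ 2) + cub2 * (z1 + z2) + cub1 =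
    slope_num z1 z2 w1 - lam * slope_den z2 w1 w2.
  rewrite /w1 /w2 lineP1 lineP2 /cub3 /cub2 /cub1 /slope_num /slope_den; ring.
rewrite lamP subrr in dd.
have -> : cub1 = - cub3 * (z1 ^+ 2 + z1 * z2 + z2 ^+ 2) - cub2 * (z1 + z2).
  by rewrite -[LHS]subr0 -dd; ring.
by rewrite cub2E; ring.
Qed.

Lemma cubicE z : chart_eq z (lam * z + nu) <->
  cub3 * z ^+ 3 + cub2 * z ^+ 2 + cub1 * z + cub0 = 0.
Proof.
have e : cub3 * z ^+ 3 + cub2 * z ^+ 2 + cub1 * z + cub0 =
  z ^+ 3 + a1 * z * (lam * z + nu) + a2 * z ^+ 2 * (lam * z + nu) + a3 * (lam * z + nu)
    ^+ 2
  + a4 * z * (lam * z + nu) ^+ 2 + a6 * (lam * z + nu) ^+ 3 - (lam * z + nu).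
  by rewrite /cub3 /cub2 /cub1 /cub0; ring.
rewrite e; split=> [{1}<-|/eqP]; first by rewrite subrr.
by rewrite subr_eq0 => /eqP.
Qed.

Lemma cub0E : cub0 = - cub3 * (z1 * z2 * third).
Proof.
have /cubicE : chart_eq z1 (lam * z1 + nu) by rewrite -lineP1; apply: chartwP.
move=> e; rewrite -[LHS]subr0 -e cub1E cub2E; ring.
Qed.

Lemma lineP3 : chartw third = lam * third + nu.
Proof. by apply/esym/chartw_unique/cubicE; rewrite cub0E cub1E cub2E; ring. Qed.

End Line.

(** In the chart the inverse [(x, - y - a1 x - a3)] of [(x, y)] is obtained by dividing both [z] and
    [w] by this unit. *)
Definition neg_den z : O := -1 + a1 * z + a3 * chartw z.
Definition chart_neg z : O := z * unit_inv (neg_den z).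
Definition chart_add z1 z2 : O := chart_neg (third z1 z2).

Lemma red_neg_den z : red (neg_den z) = -1.
Proof. by rewrite /neg_den !red_simp. Qed.

Lemma neg_den_neq0 z : red (neg_den z) != 0.
Proof. by rewrite red_neg_den oppr_eq0 oner_eq0. Qed.

Lemma chartw_neg z : chartw (chart_neg z) = chartw z * unit_inv (neg_den z).
Proof.
apply/esym/chartw_unique; rewrite /chart_neg; set u := unit_inv _; set w := chartw z.
have du : neg_den z * u = 1 by apply/unit_invP/neg_den_neq0.
have wE := chartwP z; rewrite -/w in wE.
rewrite /chart_eq; transitivity (w * (neg_den z * u) ^+ 2 * u).
  by rewrite du expr1n mulr1.
have e : w * neg_den z ^+ 2 = z ^+ 3 + a1 * z * w * neg_den z + a2 * z ^+ 2 * w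
    + a3 * w ^+ 2 * neg_den z + a4 * z * w ^+ 2 + a6 * w ^+ 3.
  apply/eqP; rewrite -subr_eq0; apply/eqP.
  move/eqP: wE; rewrite -subr_eq0 => /eqP wE; rewrite -[RHS]wE /neg_den -/w; ring.
transitivity (w * neg_den z ^+ 2 * u ^+ 3); first by ring.
(* Factors [neg_den z * u = 1] are inserted to make every term homogeneous of degree 3 in [u]. *)
transitivity ((z * u) ^+ 3 + a1 * (z * u) * (w * u) * (neg_den z * u)
  + a2 * (z * u) ^+ 2 * (w * u) + a3 * (w * u) ^+ 2 * (neg_den z * u)
  + a4 * (z * u) * (w * u) ^+ 2 + a6 * (w * u) ^+ 3); first by rewrite e; ring.
by rewrite du !mulr1.
Qed.

Lemma red_unit_inv x : red x != 0 -> red (unit_inv x) = (red x)^-1.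
Proof.
move=> x0; apply: (mulfI x0); rewrite -rmorphM unit_invP // rmorph1.
by rewrite divff.
Qed.

Lemma red_chart_add z1 z2 : red (chart_add z1 z2) = red z1 + red z2.
Proof.
rewrite /chart_add /chart_neg rmorphM red_unit_inv ?neg_den_neq0 // red_neg_den.
by rewrite /third /cub2 invrN1 !red_simp; ring.
Qed.

Lemma divides_chartw t z : divides t z -> divides (t ^+ 2) (chartw z).
Proof.
move=> tz; have e : chartw z * slope_den z (chartw z) 0 = z ^+ 3.
  have := slopeP (chartwP 0) (chartwP z); rewrite chartw0 /slope_num !subr0.
  rewrite /slope_den => e; apply: etrans (etrans e _); ring.
rewrite -[chartw z]mulr1 -(unit_invP (slope_den_neq0 z (chartw z) 0)) mulrA e.
by apply: dividesMr; rewrite [z ^+ 3]exprSr; apply/dividesMr/dividesXX.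
Qed.

Lemma divides_chart_neg t z : divides t z -> divides (t ^+ 2) (chart_neg z + z).
Proof.
move=> tz; have du : neg_den z * unit_inv (neg_den z) = 1.
  exact/unit_invP/neg_den_neq0.
have -> : chart_neg z + z = unit_inv (neg_den z) * (z * (a1 * z + a3 * chartw z)).
  rewrite -[X in _ + X]mulr1 -du /chart_neg; set u := unit_inv _.
  by rewrite /neg_den; ring.
apply: dividesMl; rewrite expr2; apply: dividesM => //.
apply: dividesD; apply: dividesMl => //.
by apply: divides_trans (divides_chartw tz); rewrite expr2; apply/dividesMr/dividesd.
Qed.

(** Slope and intercept of the line vanish modulo [t^2], hence so does [cub2]: the third point is
    [- z1 - z2] and negation is a change of sign, both modulo [t^2]. *)
Lemma divides_chart_add t z1 z2 : divides t z1 -> divides t z2 ->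
  divides (t ^+ 2) (chart_add z1 z2 - (z1 + z2)).
Proof.
move=> t1 t2; have w1t := divides_chartw t1.
have lt : divides (t ^+ 2) (lam z1 z2).
  apply/dividesMr; rewrite /slope_num; do ![apply: dividesD].
  - exact: dividesXX.
  - by rewrite expr2; apply: dividesM.
  - exact: dividesXX.
  - exact: dividesMl.
  - exact: dividesMl.
  - by apply/dividesMl; rewrite expr2; apply: dividesMl.
have nt : divides (t ^+ 2) (nu z1 z2) by apply: dividesB => //; apply: dividesMr.
have ct : divides (t ^+ 2) (cub2 z1 z2).
  rewrite /cub2; do ![apply: dividesD].
  - exact: dividesMl.
  - exact: dividesMl.
  - by apply/dividesMl; rewrite expr2; apply: dividesMl.
  - exact: dividesMl.
  - exact: dividesMl.
have t3 : divides t (third z1 z2).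
  apply: dividesB; first by apply: dividesB => //; apply: dividesN.
  by apply: dividesMr; apply: divides_trans ct; rewrite expr2; apply/dividesMr/dividesd.
have -> : chart_add z1 z2 - (z1 + z2) =
  (chart_add z1 z2 + third z1 z2) + cub2 z1 z2 * unit_inv (cub3 z1 z2).
  by rewrite [third]lock; unlock third; rewrite /third; ring.
by apply: dividesD; [apply: divides_chart_neg|apply: dividesMr].
Qed.

Section Congruence.
Variable d : O.
Local Notation "x == y" := (divides d (x - y)).

Let cong_refl x : x == x. Proof. by rewrite subrr; apply: divides0. Qed.
Let congN x y : x == y -> - x == - y.
Proof. by move=> e; rewrite -opprD; apply: dividesN. Qed.
Let congD x x' y y' : x == x' -> y == y' -> x + y == x' + y'.
Proof. by move=> e e'; rewrite opprD addrACA; apply: dividesD. Qed.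
Let congM x x' y y' : x == x' -> y == y' -> x * y == x' * y'.
Proof.
move=> e e'; have -> : x * y - x' * y' = (x - x') * y + x' * (y - y') by ring.
by apply: dividesD; [apply: dividesMr|apply: dividesMl].
Qed.
Let congX x y n : x == y -> x ^+ n == y ^+ n.
Proof. by move=> e; rewrite subrXX; apply: dividesMr. Qed.
Let cong_inv x y : red x != 0 -> red y != 0 -> x == y -> unit_inv x == unit_inv y.
Proof.
move=> ux uy [c e]; exists (- c * unit_inv x * unit_inv y).
have -> : unit_inv x - unit_inv y = - (x - y) * unit_inv x * unit_inv y;
  last by rewrite e; ring.
transitivity (unit_inv x * (y * unit_inv y) - unit_inv y * (x * unit_inv x));
  last by ring.
by rewrite !unit_invP // !mulr1.
Qed.
(** The chord has an integral slope, by which [z - z'] is multiplied. *)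
Lemma cong_chartw z z' : z == z' -> chartw z == chartw z'.
Proof.
move=> e; rewrite (lineP1 z z') (lineP2 z z') opprD addrACA subrr addr0 -mulrBr.
exact: dividesMl.
Qed.

Lemma chart_add_cong z z' y : z == z' -> chart_add z y == chart_add z' y.
Proof.
move=> e; have ew := cong_chartw e.
have cD : slope_den y (chartw z) (chartw y) == slope_den y (chartw z') (chartw y).
  by rewrite /slope_den; do ![done | apply: congD | apply: congM | apply: congN |
    apply: congX].
have cN : slope_num z y (chartw z) == slope_num z' y (chartw z').
  by rewrite /slope_num; do ![done | apply: congD | apply: congM | apply: congN |
    apply: congX].
have cl : lam z y == lam z' y.
  by apply: congM => //; apply: cong_inv; rewrite ?slope_den_neq0.
have cn : nu z y == nu z' y.
  by apply: congD => //; apply/congN/congM.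
have c3 : cub3 z y == cub3 z' y.
  by rewrite /cub3; do ![done | apply: congD | apply: congM | apply: congN | apply:
    congX].
have c2 : cub2 z y == cub2 z' y.
  by rewrite /cub2; do ![done | apply: congD | apply: congM | apply: congN | apply:
    congX].
have ct : third z y == third z' y.
  rewrite /third; apply: congD; first by apply: congD => //; apply: congN.
  by apply/congN/congM => //; apply: cong_inv; rewrite ?cub3_neq0.
apply: congM => //; apply: cong_inv; rewrite ?neg_den_neq0 //.
by rewrite /neg_den; do ![done | apply: cong_chartw | apply: congD | apply: congM |
  apply: congN | apply: congX].
Qed.

End Congruence.

(** * From the chart to points over a field *)

Section Points.
Variables (F : fieldType) (iota : {rmorphism O -> F}).
Hypothesis iota_inj : injective iota.
Local Notation WF := (wmap iota W).

Definition iota_simp := (rmorphD iota, rmorphM iota, rmorphN iota, rmorphXn iota,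
  rmorph1 iota, rmorph0 iota, rmorph_nat iota).

Lemma iota_unit_neq0 x : red x != 0 -> iota x != 0.
Proof.
move=> /unit_invP /(congr1 iota); rewrite rmorphM rmorph1 => e.
by apply/eqP => x0; move/eqP: e; rewrite x0 mul0r eq_sym oner_eq0.
Qed.

Lemma iota_eq0 x : (iota x == 0) = (x == 0).
Proof. by rewrite -(inj_eq iota_inj) rmorph0. Qed.

Lemma chartw_eq0 z : (iota (chartw z) == 0) = (z == 0).
Proof.
rewrite iota_eq0; apply/eqP/eqP => [w0|->]; last exact: chartw0.
have := chartwP z; rewrite /chart_eq w0 !expr0n /= !mulr0 !addr0 => /esym/(congr1 iota).
rewrite rmorphXn rmorph0 => /eqP; rewrite expf_eq0 iota_eq0 => /andP[_ /eqP].
by [].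
Qed.

Definition chart_point z : option (F * F) :=
  if z == 0 then None else Some (iota z / iota (chartw z), - (iota (chartw z))^-1).

Lemma chart_point_inj : injective chart_point.
Proof.
move=> x y; rewrite /chart_point; case: eqVneq => [->|x0]; case: eqVneq => [->|y0] //.
move=> [e /oppr_inj/invr_inj w_eq]; apply: iota_inj; rewrite w_eq in e.
by apply: (mulIf _ e); rewrite invr_eq0 chartw_eq0.
Qed.

Lemma chart_point_neg z : chart_point (chart_neg z) = affine_neg WF (chart_point z).
Proof.
have d0 : iota (neg_den z) != 0 := iota_unit_neq0 (neg_den_neq0 z).
have du : iota (unit_inv (neg_den z)) = (iota (neg_den z))^-1.
  apply: (mulfI d0); rewrite divff // -rmorphM unit_invP ?rmorph1 //.
  exact: neg_den_neq0.
have eq0 : (chart_neg z == 0) = (z == 0).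
  by rewrite -iota_eq0 rmorphM du mulf_eq0 invr_eq0 (negPf d0) orbF iota_eq0.
rewrite /chart_point eq0; case: eqVneq => //= z0.
have w0 : iota (chartw z) != 0 by rewrite chartw_eq0.
rewrite chartw_neg /chart_neg !rmorphM du; congr (Some (_, _)); first by field;
  rewrite w0.
move: d0; rewrite /neg_den !iota_simp => d0.
by field; rewrite w0 d0.
Qed.

(** [slope_den z w w] is the derivative of the chart equation with respect to [w]. It is a unit,
    while it would vanish at a singular point. *)
Lemma chart_point_good z : good WF (chart_point z).
Proof.
rewrite /chart_point; case: eqVneq => // z0.
have w0 : iota (chartw z) != 0 by rewrite chartw_eq0.
have /(congr1 iota) := chartwP z; rewrite !iota_simp.
have : iota (slope_den z (chartw z) (chartw z)) != 0.
  exact/iota_unit_neq0/slope_den_neq0.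
rewrite /slope_den !iota_simp; move: w0.
move: (iota (chartw z)) (iota z) => w x w0 den e; split=> /=.
  apply/eqP; rewrite -subr_eq0; apply/eqP; move/eqP: e; rewrite -subr_eq0 => /eqP e.
  rewrite -[RHS](mul0r (w ^+ 3)^-1) -[in RHS]e; field; exact: w0.
move=> [D0 N0]; case/eqP: den; apply: (mulfI w0); rewrite mulr0.
move/eqP: e; rewrite -subr_eq0 => /eqP e.
rewrite -[RHS](addr0 0) -{1}(mulr0 (x * w ^+ 2)) -{1}N0 -(mulr0 (w ^+ 2)) -[in RHS]D0.
rewrite -[RHS]addr0 -[X in _ = _ + X](mulr0 3) -[in RHS]e; field; exact: w0.
Qed.

Lemma collinear_of_line (z1 z2 z3 l n : F) :
    let b1 := wa1 WF in let b2 := wa2 WF in let b3 := wa3 WF in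
    let b4 := wa4 WF in let b6 := wa6 WF in
    let c := 1 + b2 * l + b4 * l ^+ 2 + b6 * l ^+ 3 in
    c != 0 -> n != 0 ->
    l * z1 + n != 0 -> l * z2 + n != 0 -> l * z3 + n != 0 ->
    b1 * l + b2 * n + b3 * l ^+ 2 + 2 * b4 * l * n + 3 * b6 * l ^+ 2 * n =
      - c * (z1 + z2 + z3) ->
    b1 * n - l + 2 * b3 * l * n + b4 * n ^+ 2 + 3 * b6 * l * n ^+ 2 =
      c * (z1 * z2 + z1 * z3 + z2 * z3) ->
    b3 * n ^+ 2 - n + b6 * n ^+ 3 = - c * (z1 * z2 * z3) ->
  collinear WF (Some (z1 / (l * z1 + n), - (l * z1 + n)^-1))
    (Some (z2 / (l * z2 + n), - (l * z2 + n)^-1))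
    (Some (z3 / (l * z3 + n), - (l * z3 + n)^-1)).
Proof.
move=> b1 b2 b3 b4 b6 c c0 n0 w1 w2 w3 e2 e1 e0.
(* This is the cubic evaluated at [z = - n / l], where the line meets [w = 0] and only the term
   [z^3] of the equation is left. *)
have prodE : c * ((l * z1 + n) * (l * z2 + n) * (l * z3 + n)) = n ^+ 3.
  transitivity (- l ^+ 3 * (- c * (z1 * z2 * z3)) + l ^+ 2 * n * (c * (z1 * z2 + z1 *
    z3 + z2 * z3))
    - l * n ^+ 2 * (- c * (z1 + z2 + z3)) + n ^+ 3 * c); first by ring.
  by rewrite -e0 -e1 -e2 /c; ring.
(* Multiplying [w = l z + n] by [y] gives [-1 = - l x + n y]. *)
exists (l / n), (- n^-1); split; [by field; rewrite ?w1 ?w2 ?w3 ?n0..|split].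
- transitivity ((-3 * l ^+ 2 * (- c * (z1 * z2 * z3))
    + 2 * l * n * (c * (z1 * z2 + z1 * z3 + z2 * z3))
    - n ^+ 2 * (- c * (z1 + z2 + z3))) / (c * ((l * z1 + n) * (l * z2 + n) * (l * z3 +
        n)))).
    by field; rewrite w1 w2 w3 c0.
  by rewrite prodE -e0 -e1 -e2 -/b1 -/b2; field.
- transitivity ((-3 * l * (- c * (z1 * z2 * z3))
    + n * (c * (z1 * z2 + z1 * z3 + z2 * z3))) /
    (c * ((l * z1 + n) * (l * z2 + n) * (l * z3 + n)))).
    by field; rewrite w1 w2 w3 c0.
  by rewrite prodE -e0 -e1 -/b1 -/b3 -/b4; field.
- transitivity (- (- c * (z1 * z2 * z3)) / (c * ((l * z1 + n) * (l * z2 + n) * (l * z3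
    + n)))).
    by field; rewrite w1 w2 w3 c0.
  by rewrite prodE -e0 -/b3 -/b6; field.
Qed.

(* The points [x], [y] and the origin on the line [w = l z]. *)
Lemma chart_point_neg_of_line (x y l c : O) :
    red c != 0 -> chartw x = l * x -> chartw y = l * y ->
    c * (x * y) = - l -> c * (x + y) = - (a1 + a3 * l) * l ->
  chart_point y = affine_neg WF (chart_point x).
Proof.
move=> c0 wx wy e1 e2; have ic0 := iota_unit_neq0 c0.
have sumE : x + y = (a1 + a3 * l) * (x * y).
  by apply: (unit_mulI c0); rewrite e2 mulrCA e1; ring.
have xy0 : (x == 0) = (y == 0).
  by apply/eqP/eqP => e; move: sumE; rewrite e ?(mul0r, mulr0, addr0, add0r).
have [y0|y0] := eqVneq y 0; first by rewrite /chart_point xy0 y0 eqxx.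
have x0 : x != 0 by rewrite xy0.
rewrite /chart_point (negPf x0) (negPf y0) /=.
have ix0 : iota x != 0 by rewrite iota_eq0.
have iy0 : iota y != 0 by rewrite iota_eq0.
have il0 : iota l != 0.
  have : iota c * (iota x * iota y) != 0 by rewrite !mulf_neq0.
  by rewrite -!rmorphM e1 rmorphN oppr_eq0.
move/(congr1 iota): sumE; rewrite wx wy !iota_simp => sumE.
congr (Some (_, _)); first by field; rewrite ix0 iy0 il0.
apply/eqP; rewrite -subr_eq0; apply/eqP.
transitivity ((- (iota x + iota y) + (iota a1 + iota a3 * iota l) * (iota x * iota y))
  / (iota l * iota x * iota y)); first by field; rewrite ix0 iy0 il0.
by rewrite sumE addNr mul0r.
Qed.

Lemma chart_point_collinear z1 z2 : collinear WF (chart_point z1) (chart_point z2)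
  (chart_point (third z1 z2)).
Proof.
have p1 := lineP1 z1 z2; have p2 := lineP2 z1 z2; have p3 := lineP3 z1 z2.
have e2 := cub2E z1 z2; have e1 := cub1E z1 z2; have e0 := cub0E z1 z2.
have c0 := cub3_neq0 z1 z2.
move: p1 p2 p3 e2 e1 e0 c0; move: (third z1 z2) => z3.
set l := lam z1 z2; set n := nu z1 z2; set c := cub3 z1 z2 => p1 p2 p3 e2 e1 e0 c0.
have n00 z : z = 0 -> chartw z = l * z + n -> n = 0.
  by move=> ->; rewrite chartw0 mulr0 add0r.
(* If one of the three points is the origin, the line passes through [(0, 0)], and the other two
   points are opposite. *)
have side x y : n = 0 -> c * (x * y) = cub1 z1 z2 -> - c * (x + y) = cub2 z1 z2 ->
    chartw x = l * x + n -> chartw y = l * y + n ->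
      chart_point y = affine_neg WF (chart_point x).
  rewrite /cub1 /cub2 -/l -/n => -> c1 c2; rewrite !addr0 => px py.
  apply: (chart_point_neg_of_line c0 px py); first by rewrite c1; ring.
  by rewrite -[LHS]opprK -mulNr c2; ring.
have [z10|z10] := eqVneq z1 0.
  have -> : chart_point z1 = None by rewrite /chart_point z10 eqxx.
  apply: side => //; first exact: n00 z10 p1.
  - by rewrite e1 z10; ring.
  - by rewrite e2 z10; ring.
have [z20|z20] := eqVneq z2 0.
  have -> : chart_point z2 = None by rewrite /chart_point z20 eqxx.
  suff e : chart_point z3 = affine_neg WF (chart_point z1) by case: (chart_point z1) e
    => [[]|].
  apply: side => //; first exact: n00 z20 p2.
  - by rewrite e1 z20; ring.
  - by rewrite e2 z20; ring.
have [z30|z30] := eqVneq z3 0.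
  have -> : chart_point z3 = None by rewrite /chart_point z30 eqxx.
  have : chart_point z2 = affine_neg WF (chart_point z1).
    apply: side => //; first exact: n00 z30 p3.
    - by rewrite e1 z30; ring.
    - by rewrite e2 z30; ring.
  by rewrite /chart_point (negPf z10) (negPf z20).
have w10 : iota (chartw z1) != 0 by rewrite chartw_eq0.
have w20 : iota (chartw z2) != 0 by rewrite chartw_eq0.
have w30 : iota (chartw z3) != 0 by rewrite chartw_eq0.
rewrite /chart_point (negPf z10) (negPf z20) (negPf z30).
have cE : c = 1 + a2 * l + a4 * l ^+ 2 + a6 * l ^+ 3 by [].
move: e2 e1 e0; rewrite /cub2 /cub1 /cub0 -/l -/n => e2 e1 e0.
clear side n00; clearbody c; clearbody n; clearbody l.
move: w10 w20 w30; rewrite p1 p2 p3 !iota_simp => w10 w20 w30.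
have ic0 := iota_unit_neq0 c0.
have n0 : iota n != 0.
  have : iota c * (iota z1 * iota z2 * iota z3) != 0.
    by rewrite !mulf_neq0 // iota_eq0.
  apply: contraNneq => n0; have n0' : n = 0 by apply: iota_inj; rewrite n0 rmorph0.
  move/(congr1 iota): e0; rewrite n0' !expr0n /= !mulr0 subrr addr0.
  by rewrite mulNr rmorphN rmorph0 !rmorphM => /esym/eqP; rewrite oppr_eq0.
rewrite cE in e2 e1 e0 ic0; move: ic0 e2 e1 e0 => ic0.
move=> /(congr1 iota) e2 /(congr1 iota) e1 /(congr1 iota) e0.
rewrite !iota_simp in ic0 e2 e1 e0.
exact: collinear_of_line.
Qed.

Lemma chart_point_add z1 z2 : chart_point (chart_add z1 z2) = affine_add WF
  (chart_point z1) (chart_point z2).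
Proof.
rewrite chart_point_neg (collinear_unique (chart_point_good z1) (chart_point_good z2)
  (chart_point_collinear z1 z2)).
exact: affine_negK.
Qed.

Lemma chart_addA : associative chart_add.
Proof.
move=> x y z; apply: chart_point_inj; rewrite !chart_point_add; apply/esym.
by apply: affine_addA; rewrite -?chart_point_add; apply: chart_point_good.
Qed.

Lemma chart_addC : commutative chart_add.
Proof.
move=> x y; apply: chart_point_inj; rewrite !chart_point_add.
by apply: affine_addC; apply: chart_point_good.
Qed.

Lemma chart_add0 : left_id 0 chart_add.
Proof. by move=> x; apply: chart_point_inj;
  rewrite chart_point_add {1}/chart_point eqxx. Qed.

Lemma chart_addN : left_inverse 0 chart_neg chart_add.
Proof.
move=> x; apply: chart_point_inj.
by rewrite chart_point_add chart_point_neg affine_addN /chart_point eqxx.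
Qed.

End Points.

End Chart.

(** * Coordinate changes and cusps *)

(* The equation in the coordinates [x', y'] with [x = x' + r] and [y = y' + s x' + u]. *)
Definition wchange (R : comNzRingType) (r s u : R) (W : weierstrass R) : weierstrass R :=
  Weierstrass (wa1 W + 2 * s)
    (wa2 W - s * wa1 W + 3 * r - s ^+ 2)
    (wa3 W + r * wa1 W + 2 * u)
    (wa4 W - s * wa3 W + 2 * r * wa2 W - (u + r * s) * wa1 W + 3 * r ^+ 2 - 2 * s * u)
    (wa6 W + r * wa4 W + r ^+ 2 * wa2 W + r ^+ 3 - u * wa3 W - u ^+ 2 - r * u * wa1 W).

Lemma wchange_map (R S : comNzRingType) (f : {rmorphism R -> S}) (r s u : R)
    (W : weierstrass R) :
  wmap f (wchange r s u W) = wchange (f r) (f s) (f u) (wmap f W).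
Proof.
by congr Weierstrass; rewrite !(rmorphXn, rmorph_nat, rmorphB, rmorphD, rmorphM).
Qed.

(** The hypotheses describe the curve [(y - s x - t)^2 = (x - r)^3]: its cusp is [(r, s r + t)] and
    its tangent there has slope [s]. *)
Lemma wchange_cuspidal (R : comNzRingType) (W : weierstrass R) (r s t : R) :
    wa1 W = -2 * s -> wa2 W = -3 * r - s ^+ 2 -> wa3 W = -2 * t ->
    wa4 W = 3 * r ^+ 2 - 2 * s * t -> wa6 W = - r ^+ 3 - t ^+ 2 ->
  wchange r s (s * r + t) W = Weierstrass 0 0 0 0 0.
Proof. by move=> e1 e2 e3 e4 e6; congr Weierstrass; rewrite ?e1 ?e2 ?e3 ?e4 ?e6;
  ring. Qed.

Section CoordinateChange.
Variables (F : fieldType) (W : weierstrass F) (r s u : F).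
Local Notation W' := (wchange r s u W).

Definition affine_change (P : option (F * F)) : option (F * F) :=
  if P is Some (x, y) then Some (x + r, y + s * x + u) else None.

(** The change of coordinates adds [s] to every slope. *)
Lemma affine_add_change P Q : affine_on W' P -> affine_on W' Q ->
  affine_add W (affine_change P) (affine_change Q) = affine_change (affine_add W' P Q).
Proof.
case: P Q => [[x1 y1]|] [[x2 y2]|] // P_on Q_on; rewrite /affine_change /affine_add.
rewrite (inj_eq (addIr r)).
have -> : y1 + s * x1 + u + (y2 + s * x2 + u) + wa1 W * (x2 + r) + wa3 W =
   y1 + y2 + wa1 W' * x2 + wa3 W' + s * (x1 - x2) by rewrite /=; ring.
have [x12|x12] := eqVneq x1 x2; last first.
  rewrite !andFb; set l' := (y2 - y1) / _; set l := _ / _.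
  have -> : l = l' + s.
    by rewrite /l /l'; field; rewrite subr_eq0 eq_sym.
  by move: l' => l' {l}; congr (Some (_, _)); rewrite /=; ring.
rewrite !andTb x12 subrr mulr0 addr0; case: eqVneq => // nopp.
have y12 : y1 = y2.
  by apply: (@affine_same_x _ W' x2) => //; rewrite -x12.
set l := _ / _; set l' := _ / _; have -> : l = l' + s.
  rewrite /l /l' y12; set D := 2 * _ + _ * _ + _; set D' := 2 * _ + _ * _ + _.
  have DD' : D = D' by rewrite /D /D' /=; ring.
  have D'0 : D' != 0 by apply: contraNneq nopp => D0; rewrite -D0 y12 /D' /=;
    apply/eqP; ring.
  rewrite DD' -[RHS](mulfK D'0); congr (_ / _).
  by rewrite [RHS]mulrDl divfK // /D' /=; ring.
by move: l' => l' {l}; congr (Some (_, _)); rewrite /=; ring.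
Qed.
End CoordinateChange.

Lemma wpoly_map (R S : comNzRingType) (f : {rmorphism R -> S}) (W : weierstrass R)
    (v : 'rV[R]_3) :
  wpoly (wmap f W) (map_mx f v) = f (wpoly W v).
Proof. by rewrite /wpoly !mxE /= !(rmorphXn, rmorphB, rmorphD, rmorphM). Qed.

Section LineExpansion.
Variables (R : comNzRingType) (W : weierstrass R).
Local Notation a1 := (wa1 W).
Local Notation a2 := (wa2 W).
Local Notation a3 := (wa3 W).
Local Notation a4 := (wa4 W).
Local Notation a6 := (wa6 W).
Implicit Types v w : 'rV[R]_3.

Definition wder_x v := a1 * v 0 1 * v 0 2 - 3 * v 0 0 ^+ 2 - 2 * a2 * v 0 0 * v 0 2
  - a4 * v 0 2 ^+ 2.
Definition wder_y v := 2 * v 0 1 * v 0 2 + a1 * v 0 0 * v 0 2 + a3 * v 0 2 ^+ 2.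
Definition wder_z v := v 0 1 ^+ 2 + a1 * v 0 0 * v 0 1 + 2 * a3 * v 0 1 * v 0 2
  - a2 * v 0 0 ^+ 2 - 2 * a4 * v 0 0 * v 0 2 - 3 * a6 * v 0 2 ^+ 2.
Definition wder v w := wder_x v * w 0 0 + wder_y v * w 0 1 + wder_z v * w 0 2.

(** For a cubic form the quadratic term along [w] is the derivative at [w] in the direction [v]. *)
Lemma wpoly_line v w x : wpoly W (v + x *: w) =
  wpoly W v + wder v w * x + wder w v * x ^+ 2 + wpoly W w * x ^+ 3.
Proof. by rewrite /wpoly /wder /wder_x /wder_y /wder_z !mxE /=; ring. Qed.

End LineExpansion.

Lemma wder_map (R S : comNzRingType) (f : {rmorphism R -> S}) (W : weierstrass R)
    (v w : 'rV[R]_3) :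
  wder (wmap f W) (map_mx f v) (map_mx f w) = f (wder W v w).
Proof.
rewrite /wder /wder_x /wder_y /wder_z !mxE /=.
by rewrite !(rmorphXn, rmorph_nat, rmorphB, rmorphD, rmorphM).
Qed.

(** * Equation of a cuspidal curve *)

Section Cusp.
Variables (F : fieldType) (W : weierstrass F).
Local Notation a1 := (wa1 W).
Local Notation a2 := (wa2 W).
Local Notation a3 := (wa3 W).
Local Notation a4 := (wa4 W).
Local Notation a6 := (wa6 W).
Local Notation wder_x := (wder_x W).
Local Notation wder_y := (wder_y W).
Local Notation wder_z := (wder_z W).
Local Notation wder := (wder W).
Implicit Types v w : 'rV[F]_3.

Lemma wlineE v w : wline W v w = (wpoly W v)%:P + (wder v w)%:P * 'X
  + (wder w v)%:P * 'X^2 + (wpoly W w)%:P * 'X^3.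
Proof. by rewrite /wline wpoly_line !wpoly_map !wder_map. Qed.

Lemma wline_coef1 v w : (wline W v w)`_1 = wder v w.
Proof. by rewrite wlineE !coefE /=; ring. Qed.

Lemma wline_coef2 v w : (wline W v w)`_2 = wder w v.
Proof. by rewrite wlineE !coefE /=; ring. Qed.

Lemma singular_pointP v : singular_point W v <->
  [/\ v != 0, wpoly W v = 0, wder_x v = 0, wder_y v = 0 & wder_z v = 0].
Proof.
have dE (i : 'I_3) : (wline W v (delta_mx 0 i))`_1 =
    nth 0 [:: wder_x v; wder_y v; wder_z v] i.
  rewrite wline_coef1 /wder !mxE.
  by case: i => [[|[|[|//]]] lt_i]; rewrite -!val_eqE /=; ring.
split=> [[v0 Wv dv]|[v0 Wv dx dy dz]].
  by split=> //; [have := dv 0 | have := dv 1 | have := dv 2]; rewrite dE.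
split=> // i; rewrite dE.
by case: i => [[|[|[|//]]] lt_i].
Qed.

Lemma wpoly_cube v r s t : a1 = -2 * s -> a2 = -3 * r - s ^+ 2 -> a3 = -2 * t ->
    a4 = 3 * r ^+ 2 - 2 * s * t -> a6 = - r ^+ 3 - t ^+ 2 ->
  wpoly W v = (v 0 1 - s * v 0 0 - t * v 0 2) ^+ 2 * v 0 2 - (v 0 0 - r * v 0 2) ^+ 3.
Proof. by move=> e1 e2 e3 e4 e6; rewrite /wpoly e1 e2 e3 e4 e6; ring. Qed.

Lemma vec3_eq0 v : v 0 0 = 0 -> v 0 1 = 0 -> v 0 2 = 0 -> v = 0.
Proof.
move=> v0 v1 v2; apply/rowP => i; rewrite mxE.
have [->|->|->] : [\/ i = 0, i = 1 | i = 2]; [|exact: v0|exact: v1|exact: v2].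
case: i => [[|[|[|//]]] lt_i]; [constructor 1|constructor 2|constructor 3];
  exact: val_inj.
Qed.

Lemma nonsingular_cuspidal v r s t : a1 = -2 * s -> a2 = -3 * r - s ^+ 2 -> a3 = -2 * t ->
    a4 = 3 * r ^+ 2 - 2 * s * t -> a6 = - r ^+ 3 - t ^+ 2 ->
  nonsingular_point W v <-> wpoly W v = 0 /\ v 0 1 - s * v 0 0 - t * v 0 2 != 0.
Proof.
move=> e1 e2 e3 e4 e6; have wE := wpoly_cube v e1 e2 e3 e4 e6.
split=> [[v0 Wv sing]|[Wv y0]].
  split=> //; apply/eqP => y0; apply: sing; apply/singular_pointP.
  have /eqP : (v 0 0 - r * v 0 2) ^+ 3 = 0.
    transitivity ((v 0 1 - s * v 0 0 - t * v 0 2) ^+ 2 * v 0 2 - wpoly W v).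
      by rewrite wE; ring.
    by rewrite y0 Wv expr0n mul0r subr0.
  rewrite expf_eq0 /= => /eqP x0.
  split=> //.
  - have -> : wder_x v = - 2 * s * (v 0 1 - s * v 0 0 - t * v 0 2) * v 0 2
      - 3 * (v 0 0 - r * v 0 2) ^+ 2 by rewrite /wder_x e1 e2 e4; ring.
    by rewrite x0 y0; ring.
  - have -> : wder_y v = 2 * (v 0 1 - s * v 0 0 - t * v 0 2) * v 0 2.
      by rewrite /wder_y e1 e3; ring.
    by rewrite y0; ring.
  - have -> : wder_z v = (v 0 1 - s * v 0 0 - t * v 0 2) ^+ 2
      - 2 * t * (v 0 1 - s * v 0 0 - t * v 0 2) * v 0 2
      + 3 * r * (v 0 0 - r * v 0 2) ^+ 2 by rewrite /wder_z e2 e3 e4 e6 e1; ring.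
    by rewrite x0 y0; ring.
split=> //; first by apply: contraNneq y0 => ->; rewrite !mxE !mulr0 !subr0.
move=> /singular_pointP [_ _ dx dy dz]; case/eqP: (expf_neq0 2 y0).
(* The derivative in the direction [(r, s r + t, 1)] of the cusp kills both linear forms
   [Y - s X - t Z] and [X - r Z], and leaves the square of the first. *)
transitivity (wder_z v + r * wder_x v + (s * r + t) * wder_y v); last first.
  by rewrite dx dy dz !mulr0 !addr0.
by rewrite /wder_x /wder_y /wder_z e1 e2 e3 e4 e6; ring.
Qed.

(** At the singular point [(r : y : 1)] the tangent slopes are the roots of
    [S^2 + a1 S - (3 r + a2)]. A single tangent makes this a square, and the vanishing derivatives
    and the equation then give the other coefficients. *)
Lemma cusp_form v : cusp W v -> exists r s t,
  [/\ a1 = -2 * s, a2 = -3 * r - s ^+ 2, a3 = -2 * t &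
      a4 = 3 * r ^+ 2 - 2 * s * t /\ a6 = - r ^+ 3 - t ^+ 2].
Proof.
move=> [/singular_pointP [v0 Wv dx dy dz] [w [wv qw] tangent]].
have z0 : v 0 2 != 0.
  apply: contraNneq v0 => z0; apply/eqP.
  have x0 : v 0 0 = 0.
    apply/eqP; have : v 0 0 ^+ 3 == 0; last by rewrite expf_eq0.
    by rewrite -oppr_eq0 -[X in _ == X]Wv /wpoly z0; apply/eqP; ring.
  apply: vec3_eq0 => //; apply/eqP; have : v 0 1 ^+ 2 == 0; last by rewrite expf_eq0.
  by rewrite -[X in _ == X]dz /wder_z z0 x0; apply/eqP; ring.
pose r := v 0 0 / v 0 2; pose y := v 0 1 / v 0 2.
have xE : v 0 0 = r * v 0 2 by rewrite /r divfK.
have yE : v 0 1 = y * v 0 2 by rewrite /y divfK.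
have dx' : a1 * y - 3 * r ^+ 2 - 2 * a2 * r - a4 = 0.
  apply: (mulIf (expf_neq0 2 z0)); rewrite mul0r -dx /wder_x xE yE; ring.
have dy' : 2 * y + a1 * r + a3 = 0.
  apply: (mulIf (expf_neq0 2 z0)); rewrite mul0r -dy /wder_y xE yE; ring.
have dz' : y ^+ 2 + a1 * r * y + 2 * a3 * y - a2 * r ^+ 2 - 2 * a4 * r - 3 * a6 = 0.
  apply: (mulIf (expf_neq0 2 z0)); rewrite mul0r -dz /wder_z xE yE; ring.
have Wv' : y ^+ 2 + a1 * r * y + a3 * y - (r ^+ 3 + a2 * r ^+ 2 + a4 * r + a6) = 0.
  apply: (mulIf (expf_neq0 3 z0)); rewrite mul0r -Wv /wpoly xE yE; ring.
have qE (w' : 'rV[F]_3) : wder w' v = v 0 2 * ((w' 0 1 - y * w' 0 2) ^+ 2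
    + a1 * (w' 0 0 - r * w' 0 2) * (w' 0 1 - y * w' 0 2)
    - (3 * r + a2) * (w' 0 0 - r * w' 0 2) ^+ 2).
  set a := _ - r * _; set b := _ - y * _; set c := w' 0 2.
  transitivity (v 0 2 * (b ^+ 2 + a1 * a * b - (3 * r + a2) * a ^+ 2
    + 2 * c * (a * (a1 * y - 3 * r ^+ 2 - 2 * a2 * r - a4) + b * (2 * y + a1 * r + a3))
    + c ^+ 2 * (r * (a1 * y - 3 * r ^+ 2 - 2 * a2 * r - a4) + y * (2 * y + a1 * r + a3)
      + (y ^+ 2 + a1 * r * y + 2 * a3 * y - a2 * r ^+ 2 - 2 * a4 * r - 3 * a6)))).
    by rewrite /wder /wder_x /wder_y /wder_z xE yE /a /b /c; ring.
  by rewrite dx' dy' dz'; ring.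
move: qw; rewrite wline_coef2 qE; set a := _ - r * _; set b := _ - y * _ => /eqP.
rewrite mulf_eq0 (negPf z0) /= => /eqP qab.
have a0 : a != 0.
  apply: contraNneq wv => a0; apply/sub_rVP; exists (w 0 2 / v 0 2).
  have b0 : b = 0.
    apply/eqP; have : b ^+ 2 == 0; last by rewrite expf_eq0.
    by rewrite -[X in _ == X]qab a0; apply/eqP; ring.
  apply/eqP; rewrite -subr_eq0; apply/eqP/vec3_eq0; rewrite !mxE.
  - by rewrite -[RHS]a0 /a /r; field.
  - by rewrite -[RHS]b0 /b /y; field.
  - by rewrite divfK // subrr.
pose s := b / a; have sE : s ^+ 2 + a1 * s - (3 * r + a2) = 0.
  by apply: (mulIf (expf_neq0 2 a0)); rewrite mul0r -qab /s; field.
(* The direction given by the other root of the quadratic; uniqueness of the tangent identifies it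
   with [w] modulo [v]. *)
have /tangent : tangent_line W v (vec3 1 (- a1 - s) 0).
  split.
    apply/negP => /sub_rVP [h hE].
    have := congr1 (fun m : 'rV_3 => m 0 2) hE; rewrite !mxE /= => /esym/eqP.
    rewrite mulf_eq0 (negPf z0) orbF => /eqP h0.
    have := congr1 (fun m : 'rV_3 => m 0 0) hE; rewrite !mxE /= h0 mul0r => /eqP.
    by rewrite oner_eq0.
  rewrite wline_coef2 qE !mxE /=.
  transitivity (v 0 2 * (s ^+ 2 + a1 * s - (3 * r + a2))); first by ring.
  by rewrite sE mulr0.
move=> /sub_addsmxP [[h g] /= hE].
have h1 := congr1 (fun m : 'rV_3 => m 0 0) hE; have h2 := congr1 (fun m : 'rV_3 =>
  m 0 1) hE.
have h3 := congr1 (fun m : 'rV_3 => m 0 2) hE.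
move: h1 h2 h3; rewrite !mxE !big_ord1 /=.
move: (h 0 0) (g 0 0) => {hE}h {}g h1 h2 h3.
(* Subtracting [r] times, and below [y] times, the last coordinate eliminates [v]; the ratio
   [b / a = s] is then also [- a1 - s]. *)
have ga : 1 = g * a.
  rewrite h1 -[LHS]subr0 -(mulr0 r) {1}h3 xE /a; ring.
have gb : - a1 - s = g * b.
  rewrite h2 -[LHS]subr0 -(mulr0 y) {1}h3 yE /b; ring.
have a1E : a1 = - 2 * s.
  have : - a1 - s = s; last by move=> e; rewrite -[a1]opprK -(subrK s (- a1)) e; ring.
  by rewrite gb /s -[b in RHS]mul1r ga; field.
have a2E : a2 = -3 * r - s ^+ 2.
  by apply/eqP; rewrite -subr_eq0; apply/eqP; rewrite -oppr0 -sE a1E; ring.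
have a4E : a4 = 3 * r ^+ 2 - 2 * s * (y - s * r).
  by apply/eqP; rewrite -subr_eq0; apply/eqP; rewrite -oppr0 -dx' a1E a2E; ring.
have a3E : a3 = - 2 * (y - s * r).
  by apply/eqP; rewrite -subr_eq0; apply/eqP; rewrite -dy' a1E; ring.
exists r, s, (y - s * r); split=> //; split=> //.
by apply/eqP; rewrite -subr_eq0; apply/eqP; rewrite -oppr0 -Wv' a1E a2E a3E a4E; ring.
Qed.

End Cusp.

(* In characteristics 2 and 3, some of [r], [s],
  [t] are only given by their [p]-th powers. *)
Lemma cuspidal_form (p : nat) (k : fieldType) (W : weierstrass k) : p \in [pchar k] ->
    (forall a : k, exists b, b ^+ p = a) -> cuspidal_curve W -> exists r s t,
  [/\ wa1 W = -2 * s, wa2 W = -3 * r - s ^+ 2, wa3 W = -2 * t &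
      wa4 W = 3 * r ^+ 2 - 2 * s * t /\ wa6 W = - r ^+ 3 - t ^+ 2].
Proof.
move=> pk perf [L [i [v /cusp_form [r [s [t [/= e1 e2 e3 [e4 e6]]]]]]]].
have pL : p \in [pchar L] by rewrite (fmorph_pchar i).
have root (x : L) (a : k) : x ^+ p = i a -> exists b, i b = x.
  have [b <-] := perf a; rewrite rmorphXn => /eqP; rewrite -subr_eq0.
  rewrite -!(pFrobenius_autE pL) -rmorphB fmorph_eq0 subr_eq0 => /eqP ->.
  by exists b.
suff [[r' rE] [s' sE] [t' tE]] : [/\ exists b, i b = r, exists b, i b = s & exists b,
  i b = t].
  exists r', s', t'; rewrite -rE -sE -tE in e1 e2 e3 e4 e6.
  by split; [| | |split]; apply: (fmorph_inj i);
    rewrite !(rmorphXn, rmorph_nat, rmorphB, rmorphN, rmorphM).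
have p0 (n : nat) : (n%:R == 0 :> k) = (p %| n)%N by rewrite (dvdn_pcharf pk).
have [p2|p2] := eqVneq p 2%N.
  have two : 2 = 0 :> L by apply/eqP; rewrite -(rmorph_nat i) fmorph_eq0 p0 p2.
  have [r' rE] : exists b, i b = r.
    apply: (root _ (wa4 W)); rewrite p2 e4 (_ : 3 = 1 + 2); last by ring.
    by rewrite two !mul0r subr0 addr0 mul1r.
  have [s' sE] : exists b, i b = s.
    apply: (root _ (- wa2 W - 3 * r'));
      rewrite p2 rmorphB rmorphN e2 rmorphM rmorph_nat rE; ring.
  have [t' tE] : exists b, i b = t.
    apply: (root _ (- wa6 W - r' ^+ 3)); rewrite p2 rmorphB rmorphN e6 rmorphXn rE; ring.
  by split; [exists r'|exists s'|exists t'].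
have p_pr := pcharf_prime pk.
have two : 2 != 0 :> k by rewrite p0 dvdn_prime2.
have i2 : 2 != 0 :> L by rewrite -(rmorph_nat i) fmorph_eq0.
have [s' sE] : exists b, i b = s.
  by exists (- wa1 W / 2); rewrite fmorph_div rmorphN rmorph_nat e1; field.
have [t' tE] : exists b, i b = t.
  by exists (- wa3 W / 2); rewrite fmorph_div rmorphN rmorph_nat e3; field.
split; [|by exists s'|by exists t'].
have [p3|p3] := eqVneq p 3%N.
  apply: (root _ (- wa6 W - t' ^+ 2)).
  by rewrite p3 rmorphB rmorphN rmorphXn e6 tE; ring.
have i3 : 3 != 0 :> L by rewrite -(rmorph_nat i) fmorph_eq0 p0 dvdn_prime2.
exists (- (wa2 W + s' ^+ 2) / 3).
by rewrite fmorph_div rmorphN rmorphD rmorphXn rmorph_nat e2 sE; field.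
Qed.

(** * The group [E_0(K)] *)

Section Projective.
Variable F : fieldType.
Implicit Types v w : 'rV[F]_3.

Lemma eq_span v w : v != 0 -> (v == w)%MS -> exists2 a, a != 0 & v = a *: w.
Proof.
move=> v0 /andP[/sub_rVP [a vE] _]; exists a => //.
by apply: contraNneq v0 => a0; rewrite vE a0 scale0r.
Qed.

Lemma proj_pointP v w (v0 : v != 0) (w0 : w != 0) :
  proj_point v0 = proj_point w0 <-> exists2 a, a != 0 & v = a *: w.
Proof.
split=> [/eqmodP|[a a0 vE]]; first exact: eq_span.
apply/eqmodP; suff : (v == w)%MS by [].
rewrite vE {v0 vE}.
by apply/andP; split; [apply/sub_rVP; exists a | apply/sub_rVP; exists a^-1;
  rewrite scalerA mulVf ?scale1r].
Qed.

Lemma repr_proj_point v (v0 : v != 0) :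
  exists2 a, a != 0 & set_val (repr (proj_point v0)) = a *: v.
Proof.
have : repr (proj_point v0) = (exist _ v (mem_set v0) : set_type (@nonzero_vec F))
  %[mod_eq (@proportional F)]%qT by rewrite reprK.
move/eqmodP; apply: eq_span.
by have := set_valP (repr (proj_point v0)).
Qed.

Lemma of_affineK : cancel (@of_affine F) (@to_affine F).
Proof.
case=> [[x y]|]; rewrite /to_affine /of_affine.
  have [a a0 ->] := repr_proj_point (vec3_aff_neq0 x y).
  by rewrite !mxE /= mulr1 (negPf a0); congr (Some (_, _)); rewrite mulrAC divff ?mul1r.
have [a a0 ->] := repr_proj_point (vec3_inf_neq0 F).
by rewrite !mxE /= mulr0 eqxx.
Qed.

Lemma wpolyZ (R : comNzRingType) (W : weierstrass R) a (v : 'rV[R]_3) :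
  wpoly W (a *: v) = a ^+ 3 * wpoly W v.
Proof. by rewrite /wpoly !mxE; ring. Qed.

Lemma vec3_eta (R : nmodType) (v : 'rV[R]_3) : v = vec3 (v 0 0) (v 0 1) (v 0 2).
Proof.
apply/rowP => i; rewrite mxE.
by case: i => [[|[|[|//]]] lt_i] /=; congr (v 0 _); apply: val_inj.
Qed.

Lemma scale_vec3 (R : pzRingType) (a x y z : R) :
  a *: vec3 x y z = vec3 (a * x) (a * y) (a * z).
Proof. by apply/rowP => i; rewrite !mxE; case: i => [[|[|[|//]]] lt_i]. Qed.

Lemma divides_vec3 (R : comNzRingType) (d x y z x' y' z' : R) (i : 'I_3) :
    divides d (x - x') -> divides d (y - y') -> divides d (z - z') ->
  divides d (vec3 x y z 0 i - vec3 x' y' z' 0 i).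
Proof. by rewrite !mxE; case: i => [[|[|[|//]]] lt_i]. Qed.

Lemma map_vec3 (R S : Type) (f : R -> S) (x y z : R) :
  map_mx f (vec3 x y z) = vec3 (f x) (f y) (f z).
Proof. by apply/rowP => i; rewrite !mxE; case: i => [[|[|[|//]]] lt_i]. Qed.

End Projective.

Section E0Chart.
Variables (p : nat) (p_pr : prime p) (K : fieldExtType (padic_num p_pr)).
Variables (k : fieldType) (red : {rmorphism int_ring K -> k}).
Hypothesis red_surj : forall a : k, exists x : int_ring K, red x = a.
Variables (W : weierstrass (int_ring K)) (r s t : int_ring K).
Local Notation O := (int_ring K).
Local Notation Kp := (padic_field K).
Local Notation Wk := (special_fiber red W).
Hypotheses (e1 : wa1 Wk = -2 * red s) (e2 : wa2 Wk = -3 * red r - red s ^+ 2).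
Hypotheses (e3 : wa3 Wk = -2 * red t) (e4 : wa4 Wk = 3 * red r ^+ 2 - 2 * red s * red t).
Hypothesis e6 : wa6 Wk = - red r ^+ 3 - red t ^+ 2.

Definition val_field : {rmorphism O -> Kp} := (@int_val p p_pr K : {rmorphism O -> K}).
Local Notation iota := val_field.

Lemma val_field_inj : injective iota.
Proof. exact: int_val_inj. Qed.

Let u : O := s * r + t.
Let W' : weierstrass O := wchange r s u W.

Let red_W' : wmap red W' = Weierstrass 0 0 0 0 0.
Proof. by rewrite wchange_map rmorphD rmorphM; apply: wchange_cuspidal. Qed.

Let red_a1 : red (wa1 W') = 0 := congr1 (@wa1 k) red_W'.
Let red_a2 : red (wa2 W') = 0 := congr1 (@wa2 k) red_W'.
Let red_a3 : red (wa3 W') = 0 := congr1 (@wa3 k) red_W'.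
Let red_a4 : red (wa4 W') = 0 := congr1 (@wa4 k) red_W'.
Let red_a6 : red (wa6 W') = 0 := congr1 (@wa6 k) red_W'.

Let unitO := red_unit red_surj.
Let surjO := @int_surj p p_pr K.
Local Notation cw := (chartw unitO surjO red_a1 red_a2 red_a3 red_a4 red_a6).
Local Notation add := (chart_add unitO surjO red_a1 red_a2 red_a3 red_a4 red_a6).
Local Notation neg := (chart_neg unitO surjO red_a1 red_a2 red_a3 red_a4 red_a6).
Local Notation pt := (chart_point unitO surjO red_a1 red_a2 red_a3 red_a4 red_a6 iota).

(* The special fiber is [yform ^ 2 Z = xform ^ 3], and the chart on [E_0(K)] is given by
   [z = - xform / yform] and [w = - Z / yform]. *)
Definition plane_vec (z w : O) : 'rV[O]_3 :=
  vec3 (z + r * w) (-1 + s * z + u * w) w.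
Definition xform (v : 'rV[O]_3) : O := v 0 0 - r * v 0 2.
Definition yform (v : 'rV[O]_3) : O := v 0 1 - s * v 0 0 - t * v 0 2.

Lemma xform_plane_vec z w : xform (plane_vec z w) = z.
Proof. by rewrite /xform !mxE /=; ring. Qed.
Lemma yform_plane_vec z w : yform (plane_vec z w) = -1.
Proof. by rewrite /yform !mxE /= /u; ring. Qed.

Lemma wpoly_plane_vec z w : wpoly W (plane_vec z w) = w - (z ^+ 3 + wa1 W' * z * w
  + wa2 W' * z ^+ 2 * w + wa3 W' * w ^+ 2 + wa4 W' * z * w ^+ 2 + wa6 W' * w ^+ 3).
Proof. by rewrite /wpoly !mxE /=; ring. Qed.

Let cwP := chartwP unitO surjO red_a1 red_a2 red_a3 red_a4 red_a6.

Lemma wpoly_chart z : wpoly W (plane_vec z (cw z)) = 0.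
Proof. by rewrite wpoly_plane_vec -[X in _ - X]cwP subrr. Qed.

Lemma yform_scale a (v : 'rV[O]_3) : yform (a *: v) = a * yform v.
Proof. by rewrite /yform !mxE; ring. Qed.

Definition field_vec z : 'rV[Kp]_3 := map_mx iota (plane_vec z (cw z)).

Lemma field_vecE z i : field_vec z 0 i = iota (plane_vec z (cw z) 0 i).
Proof. by rewrite mxE. Qed.

Lemma field_vec_y z : field_vec z 0 1 - iota s * field_vec z 0 0 - iota t * field_vec z
  0 2 = -1.
Proof.
rewrite !field_vecE -!(rmorphM iota) -!(rmorphB iota) -/(yform _) yform_plane_vec.
by rewrite (rmorphN iota) rmorph1.
Qed.

Lemma field_vec_x z : field_vec z 0 0 - iota r * field_vec z 0 2 = iota z.
Proof.
by rewrite !field_vecE -!(rmorphM iota) -!(rmorphB iota) -/(xform _) xform_plane_vec.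
Qed.

Lemma field_vec_neq0 z : field_vec z != 0.
Proof.
apply/eqP => v0; have /eqP := field_vec_y z.
by rewrite v0 !mxE !mulr0 !subr0 eq_sym oppr_eq0 oner_eq0.
Qed.

Definition plane_pt z : padic_plane K := proj_point (field_vec_neq0 z).

Lemma plane_ptE z :
  plane_pt z = of_affine (affine_change (iota r) (iota s) (iota u) (pt z)).
Proof.
rewrite /chart_point; case: eqVneq => [->|z0]; rewrite /affine_change /of_affine;
  apply/proj_pointP.
  exists (-1); first by rewrite oppr_eq0 oner_eq0.
  have c0 : cw 0 = 0 by apply: chartw0.
  rewrite /field_vec /plane_vec c0 !mulr0 !addr0 map_vec3 scale_vec3 mulr0 mulr1.
  by rewrite (rmorphN iota) !rmorph0 rmorph1.
have w0 : iota (cw z) != 0 by rewrite chartw_eq0 //; apply: val_field_inj.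
exists (iota (cw z)) => //; rewrite /field_vec /plane_vec map_vec3 scale_vec3.
congr vec3; rewrite ?mulr1 //; first by rewrite (rmorphD iota) (rmorphM iota); field.
have uE : iota u = iota s * iota r + iota t by rewrite (rmorphD iota) (rmorphM iota).
by rewrite !(rmorphD iota) !(rmorphM iota) (rmorphN iota) (rmorph1 iota) uE; field.
Qed.

Lemma to_affine_plane_pt z :
  to_affine (plane_pt z) = affine_change (iota r) (iota s) (iota u) (pt z).
Proof. by rewrite plane_ptE of_affineK. Qed.

Lemma plane_pt_add x y :
  plane_pt (add x y) = curve_add (generic_fiber W) (plane_pt x) (plane_pt y).
Proof.
rewrite /curve_add (to_affine_plane_pt x) (to_affine_plane_pt y) plane_ptE.
congr of_affine.
have W'E : wmap iota W' = wchange (iota r) (iota s) (iota u) (generic_fiber W).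
  exact: (wchange_map iota).
have good_pt z : affine_on (wchange (iota r) (iota s) (iota u) (generic_fiber W)) (pt z).
  by rewrite -W'E; have [] := chart_point_good unitO surjO red_a1 red_a2 red_a3 red_a4
    red_a6 val_field_inj z.
rewrite affine_add_change // -W'E; congr affine_change.
by apply: chart_point_add; apply: val_field_inj.
Qed.

Lemma plane_pt_inj : injective plane_pt.
Proof.
move=> x y /proj_pointP [a _ e]; apply: val_field_inj.
have ey := field_vec_y x; have ex := field_vec_x x.
have a1E : a = 1.
  apply: oppr_inj; rewrite -[RHS]ey e -mulrN1 -(field_vec_y y) !mxE; ring.
by rewrite -field_vec_x e a1E scale1r field_vec_x.
Qed.

Lemma red_yform (v : 'rV[O]_3) : map_mx red v 0 1 - red s * map_mx red v 0 0
  - red t * map_mx red v 0 2 = red (yform v).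
Proof. by rewrite !mxE -!rmorphM -!rmorphB. Qed.

Lemma plane_pt_E0 z : E0 red W (plane_pt z).
Proof.
split.
  exists (field_vec z); first by exists (field_vec_neq0 z).
  by rewrite /field_vec wpoly_map wpoly_chart rmorph0.
exists (plane_vec z (cw z)); first by exists (field_vec_neq0 z).
apply/(nonsingular_cuspidal _ e1 e2 e3 e4 e6); split.
  by rewrite wpoly_map wpoly_chart rmorph0.
rewrite red_yform yform_plane_vec rmorphN rmorph1.
by rewrite oppr_eq0 oner_eq0.
Qed.

(** Nonsingularity makes [yform v] a unit, so [v] can be rescaled to have [yform] equal to [-1];
    uniqueness of [w] in the chart does the rest. *)
Lemma E0_plane_pt P : E0 red W P -> exists z, P = plane_pt z.
Proof.
move=> [[v' [v'0 ->] Wv'] [v [v0 /proj_pointP [a a0 vE]]]].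
move/(nonsingular_cuspidal _ e1 e2 e3 e4 e6) => [_ y0].
have Wv : wpoly W v = 0.
  apply: val_field_inj; rewrite rmorph0 -wpoly_map.
  apply: (mulfI (expf_neq0 3 a0)); rewrite mulr0 -wpolyZ -Wv'.
  by congr wpoly; rewrite vE.
have [y' yy'] : exists y', yform v * y' = 1.
  by apply: unitO; rewrite -red_yform.
pose z := xform (- y' *: v); pose w := (- y' *: v) 0 2.
have vzw : - y' *: v = plane_vec z w.
  have yv : yform (- y' *: v) = -1 by rewrite yform_scale -yy'; ring.
  rewrite [LHS]vec3_eta /plane_vec -/w; congr vec3; first by rewrite /z /xform -/w; ring.
  have -> : -1 = yform (- y' *: v) by rewrite yv.
  by rewrite /yform /z /xform -/w /u; ring.
have wE : w = cw z.
  apply: chartw_unique; apply/eqP; rewrite -subr_eq0 -wpoly_plane_vec -vzw.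
  by rewrite wpolyZ Wv mulr0.
exists z; apply/proj_pointP.
have yv0 : iota (- y') != 0.
  apply/eqP => /(congr1 (fun c => - (iota (yform v) * c))) /eqP.
  by rewrite -rmorphM mulrN yy' mulr0 oppr0 rmorphN rmorph1 opprK oner_eq0.
exists (a / iota (- y')); first by rewrite mulf_neq0 ?invr_eq0.
have -> : field_vec z = iota (- y') *: map_mx iota v.
  by rewrite /field_vec -wE -vzw map_mxZ.
by rewrite scalerA divfK.
Qed.

(** * The standard topology in terms of the chart *)

Local Open Scope classical_set_scope.

Definition E0_pt z : E0 red W := exist _ (plane_pt z) (mem_set (plane_pt_E0 z)).

Lemma set_val_E0_pt z : set_val (E0_pt z) = plane_pt z.
Proof. by []. Qed.

Lemma E0_pt_inj : injective E0_pt.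
Proof. by move=> x y /(congr1 set_val); apply: plane_pt_inj. Qed.

Lemma E0_pt_surj (P : E0 red W) : exists z, E0_pt z = P.
Proof.
have [z zP] := E0_plane_pt (set_valP P).
by exists z; apply: val_inj; rewrite [LHS]set_val_E0_pt -zP.
Qed.

Lemma field_vec_cong n x y (i : 'I_3) : divides (p%:R ^+ n) (x - y) ->
  exists c : O, field_vec x 0 i = field_vec y 0 i + iota c *+ p ^ n.
Proof.
move=> dxy; have dw := cong_chartw unitO surjO red_a1 red_a2 red_a3 red_a4 red_a6 dxy.
have [c cE] : divides (p%:R ^+ n) (plane_vec x (cw x) 0 i - plane_vec y (cw y) 0 i).
  move: dxy dw; rewrite /plane_vec; move: (cw x) (cw y) => wx wy dxy dw.
  apply: divides_vec3 => //.
  - have -> : x + r * wx - (y + r * wy) = (x - y) + r * (wx - wy) by ring.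
    by apply: dividesD => //; apply: dividesMl.
  - have -> : -1 + s * x + u * wx - (-1 + s * y + u * wy) = s * (x - y) + u * (wx - wy).
      by rewrite /u; ring.
    by apply: dividesD; apply: dividesMl.
have e : plane_vec x (cw x) 0 i = plane_vec y (cw y) 0 i + c *+ p ^ n.
  by rewrite -mulr_natl natrX -cE addrC subrK.
exists c; apply: etrans (field_vecE x i) _; rewrite [X in X + _]field_vecE.
by rewrite -(rmorphMn iota) -(rmorphD iota); apply: congr1.
Qed.

Definition field_x (v : 'rV[Kp]_3) := v 0 0 - iota r * v 0 2.
Definition field_y (v : 'rV[Kp]_3) := v 0 1 - iota s * v 0 0 - iota t * v 0 2.

(* [- x / y] is congruent to [z] modulo [p ^ n] *)
Definition near_vec z n (v : 'rV[Kp]_3) : Prop :=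
  field_y v != 0 /\ exists c : O,
    field_x v + iota z * field_y v = iota (p%:R ^+ n * c) * field_y v.

Lemma near_vecZ z n a v : a != 0 -> near_vec z n v -> near_vec z n (a *: v).
Proof.
move=> a0 [y0 [c cE]].
have yE : field_y (a *: v) = a * field_y v by rewrite /field_y !mxE; ring.
have xE : field_x (a *: v) = a * field_x v by rewrite /field_x !mxE; ring.
split; first by rewrite yE mulf_neq0.
by exists c; rewrite yE xE mulrCA -mulrDr cE mulrCA.
Qed.

Lemma near_vec_open z n : open [set v | near_vec z n v].
Proof.
rewrite openE => v [y0 [c cE]].
(* [d = p^j / field_y v] is integral, so a perturbation by [p^j] is an integral multiple of
   [field_y v]. *)
have [j Oj] := integral_scale ((field_y v)^-1 : K).
pose d : O := IntRing Oj.
have dE : iota d * field_y v = p%:R ^+ j.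
  apply: (mulIf (invr_neq0 y0)); rewrite mulfK //.
  rewrite -[LHS]/(p%:R ^+ j *: ((field_y v)^-1 : K)) -mulr_algl; congr (_ * _).
  by rewrite -[LHS]/(in_alg K (p%:R ^+ j)) rmorphXn rmorph_nat.
(* The power beyond [n] lets [field_y] change only by a factor [1 + p (...)], which is a unit. *)
pose M := (j + n.+1)%N.
exists (fun _ i => [set v 0 i + e *+ p ^ M | e in [set e | e \in @integers p p_pr K]]).
  by move=> i l; exists M => //; rewrite (ord1 i).
move=> v' v'B.
have /fin_all_exists [e eE] (i : 'I_3) : exists e : O,
  v' 0 i = v 0 i + iota e * (p ^ M)%:R.
  by have [e Oe <-] := v'B 0 i; exists (IntRing Oe); rewrite mulr_natr.
pose ey := e 1 - s * e 0 - t * e 2; pose ex := e 0 - r * e 2.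
have pM : (p ^ M)%:R = iota (p%:R ^+ n.+1 * d) * field_y v.
  rewrite (rmorphM iota) -mulrA dE (rmorphXn iota) (rmorph_nat iota) -exprD natrX.
  by rewrite addnC.
have [y yE] : exists y, (1 + p%:R ^+ n * (p%:R * (d * ey))) * y = 1.
  have [y yE] := int_unit_1p (p%:R ^+ n * (d * ey)); exists y.
  by rewrite -[RHS]yE [X in 1 + X]mulrCA.
have y'E : field_y v' = field_y v * iota (1 + p%:R ^+ n * (p%:R * (d * ey))).
  transitivity (field_y v + iota ey * (p ^ M)%:R).
    rewrite /field_y !eE /ey !(rmorphB iota) !(rmorphM iota).
    by move: ((p ^ M)%:R : Kp) => q; ring.
  clear yE; clearbody ey; rewrite pM exprS.
  by rewrite !(rmorphD iota) !(rmorphM iota) rmorph1; ring.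
have x'E : field_x v' = field_x v + iota (p%:R ^+ n * (p%:R * (d * ex))) * field_y v.
  transitivity (field_x v + iota ex * (p ^ M)%:R).
    rewrite /field_x !eE /ex !(rmorphB iota) !(rmorphM iota).
    by move: ((p ^ M)%:R : Kp) => q; ring.
  by clearbody ex; rewrite pM exprS !(rmorphM iota); ring.
have yy' : field_y v = field_y v' * iota y.
  by rewrite y'E -mulrA -rmorphM yE rmorph1 mulr1.
split; first by apply: contraNneq y0 => y'0; rewrite yy' y'0 mul0r.
exists ((c + p%:R * (d * ex) + z * (p%:R * (d * ey))) * y).
transitivity (iota (p%:R ^+ n * (c + p%:R * (d * ex) + z * (p%:R * (d * ey)))) *
  field_y v).
  rewrite x'E y'E; move: (p%:R * (d * ex)) (p%:R * (d * ey)) => b b'.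
  transitivity ((field_x v + iota z * field_y v)
      + (iota (p%:R ^+ n) * iota b + iota z * iota (p%:R ^+ n) * iota b') * field_y v).
    by rewrite (rmorphD iota) rmorph1 !(rmorphM iota); ring.
  by rewrite cE (rmorphM iota) (rmorphM iota) !(rmorphD iota) (rmorphM iota z); ring.
by rewrite {1}yy' !(rmorphM iota); ring.
Qed.

Lemma near_vecP z n z' a : a != 0 -> near_vec z n (a *: field_vec z') ->
  divides (p%:R ^+ n) (z' - z).
Proof.
move=> a0 /(near_vecZ (invr_neq0 a0)); rewrite scalerA mulVf // scale1r.
move=> [_ [c]]; rewrite /field_y field_vec_y /field_x field_vec_x !mulrN1 -rmorphB
  -rmorphN.
by move=> /val_field_inj ->; apply/dividesN/dividesMr/dividesd.
Qed.

(** One direction is the continuity of the integral coordinates [field_vec z] in [z]. For the other,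
    an open set of the plane is built from the conditions [near_vec], which are open and stable
    under scaling and so descend to the quotient. *)
Lemma E0_open (U : set (E0 red W)) : open U <->
  forall z, U (E0_pt z) -> exists n, forall z', divides (p%:R ^+ n) (z' - z) ->
    U (E0_pt z').
Proof.
split=> [[V [A oA AV] VU] z|HU].
  rewrite -VU => Vz; have : A (field_vec z).
    by have /= := congr1 (fun B : set _ =>
      B (exist _ (field_vec z) (mem_set (field_vec_neq0 z)))) AV => ->.
  move: oA; rewrite openE => oA /oA [B nB sBA].
  have /fin_all_exists [m mP] (i : 'I_3) : exists m, forall e : O,
      B 0 i (field_vec z 0 i + iota e *+ p ^ m).
    have [m _ mB] := nB 0 i; exists m => e; apply: mB.
    by exists (iota e) => //; apply: int_valP.
  exists (\max_i m i)%N => z' dz.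
  have Az' : A (field_vec z').
    apply: sBA => l i; rewrite (ord1 l).
    have [|e ->] := @field_vec_cong (m i) z' z i; last exact: mP.
    by apply: divides_trans dz; apply: dividesX; apply: (leq_bigmax i).
  by have /= <- := congr1 (fun B : set _ =>
    B (exist _ (field_vec z') (mem_set (field_vec_neq0 z')))) AV.
pose nice z n := forall z', divides (p%:R ^+ n) (z' - z) -> U (E0_pt z').
pose V : set (padic_plane K) :=
  [set P | exists z n v, [/\ nice z n, hcoords P v & near_vec z n v]].
exists V.
  exists [set v | exists z n, nice z n /\ near_vec z n v].
    rewrite openE => v [z [n [nzn nv]]]; have := @near_vec_open z n.
    rewrite openE => /(_ _ nv); apply: filterS => v' nv'.
    by exists z, n.
  apply/seteqP; split=> w [z [n]].
    move=> [nzn nv]; exists z, n, (set_val w); split=> //.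
    exists (set_valP w); apply/eqmodP; suff : (set_val w == set_val w)%MS by [].
    exact/eqmxP.
  move=> [v [nzn [v0 /eqmodP e] nv]]; exists z, n; split=> //.
  have [a a0 wE] : exists2 a, a != 0 & set_val w = a *: v.
    by apply: eq_span => //; apply: (set_valP w).
  by rewrite wE; apply: near_vecZ.
apply/seteqP; split=> P; have [z' <-] := E0_pt_surj P.
  move=> [z [n [v [nzn [v0 /proj_pointP [a a0 e]] nv]]]]; apply: nzn.
  apply: (@near_vecP z n z' a^-1); first by rewrite invr_eq0.
  by rewrite e scalerA mulVf // scale1r.
move=> /HU [n nzn]; exists z', n, (field_vec z'); split=> //.
  by exists (field_vec_neq0 z').
rewrite /near_vec /field_y /field_x field_vec_y field_vec_x oppr_eq0 oner_eq0; split=> //.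
by exists 0; rewrite mulrN1 subrr mulr0 rmorph0 mul0r.
Qed.

Lemma E0_padic_module :
  exists (G : lmodType (padic_int p_pr)) (f : G -> E0 red W),
    [/\ bijective f,
        forall x y : G,
          set_val (f (x + y)) =
            curve_add (generic_fiber W) (set_val (f x)) (set_val (f y)),
        fin_gen G
      & forall U : set (E0 red W),
          open U <-> open (f @^-1` U : set (padic_module G))].
Proof.
have [G [h [h_bij hD h_fin h_open]]] := padic_module_of_group_law red_surj
  (chart_addA unitO surjO red_a1 red_a2 red_a3 red_a4 red_a6 val_field_inj)
  (chart_addC unitO surjO red_a1 red_a2 red_a3 red_a4 red_a6 val_field_inj)
  (chart_add0 unitO surjO red_a1 red_a2 red_a3 red_a4 red_a6 val_field_inj)
  (chart_addN unitO surjO red_a1 red_a2 red_a3 red_a4 red_a6 val_field_inj)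
  (divides_chart_add unitO surjO red_a1 red_a2 red_a3 red_a4 red_a6)
  (red_chart_add unitO surjO red_a1 red_a2 red_a3 red_a4 red_a6)
  (fun n => chart_add_cong unitO surjO red_a1 red_a2 red_a3 red_a4 red_a6 (d := p%:R ^+
    n)).
have [g gP] := choice E0_pt_surj.
exists G, (E0_pt \o h); split=> //.
- apply: bij_comp => //; exists g => // z; apply: E0_pt_inj; exact: gP.
- by move=> x y; rewrite /= !set_val_E0_pt hD plane_pt_add.
- move=> U; split=> [/E0_open HU|/h_open HU].
    apply/h_open => x /HU [n nU]; exists n => y; exact: nU.
  apply/E0_open => z; have [h' hK h'K] := h_bij.
  rewrite -(h'K z) => /HU [n nU]; exists n => z'; rewrite -{1 2}(h'K z').
  exact: nU.
Qed.

End E0Chart.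

Theorem proposition6 (p : nat) (p_pr : prime p)
  (K : fieldExtType (padic_num p_pr))
  (k : fieldType) (red : {rmorphism int_ring K -> k})
  (red_surj : forall a : k, exists x : int_ring K, red x = a)
  (W : weierstrass (int_ring K))
  (W_smooth : smooth_curve (generic_fiber W))
  (W_additive : cuspidal_curve (special_fiber red W)) :
  exists (G : lmodType (padic_int p_pr)) (f : G -> E0 red W),
    [/\ bijective f,
        forall x y : G,
          set_val (f (x + y)) =
            curve_add (generic_fiber W) (set_val (f x)) (set_val (f y)),
        fin_gen G
      & forall U : set (E0 red W),
          open U <-> open (f @^-1` U : set (padic_module G))]%classic.
Proof.
(* Any lifts of the cusp data serve, since the chart only requires the transformed coefficients to
   reduce to 0. *)
have [r0 [s0 [t0 [e1 e2 e3 [e4 e6]]]]] :=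
  cuspidal_form (residue_pchar red_surj) (residue_perfect red_surj) W_additive.
have [[r rE] [s sE] [t tE]] := And3 (red_surj r0) (red_surj s0) (red_surj t0).
by apply: (@E0_padic_module _ _ _ _ _ red_surj W r s t); rewrite ?rE ?sE ?tE.
Qed.
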